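(* Let $\mathbf K$ be a field of characteristic zero, let $e,g\ge 1$ be integers, $f=e+g$, and let $E,F,G$ be $\mathbf K$-vector spaces of dimensions $e,f,g$. Let $A=\mathrm{Sym}(F^*\otimes E)\otimes \mathrm{Sym}(G^*\otimes F)$, $B=A[a]$, and let $I\subset A$ and $J\subset B$ be the ideals defined in the context (so $B/J$ is the universal ring $C$ for resolutions of length two of format $(e,f,g)$ over $\mathbf K$). Then for every $i$ there is an isomorphism $$\mathrm{Tor}_i^A(A/I,\mathbf K)\cong \mathrm{Tor}_i^B(B/J,\mathbf K)$$ preserving the $\mathrm{SL}(E)\times \mathrm{SL}(F)\times \mathrm{SL}(G)$-representation structure and the homogeneous bidegree.
   Context: After choosing bases, $A=\mathbf K[\{\phi_{j,i}\},\{\psi_{k,j}\}]$ with $1\le i\le e$, $1\le j\le f$, $1\le k\le g$ (all independent indeterminates), where $\phi_{j,i}=v_j^*\otimes u_i$ and $\psi_{k,j}=w_k^*\otimes v_j$ for bases $u_i$ of $E$, $v_j$ of $F$, $w_k$ of $G$ and dual bases $v_j^*$, $w_k^*$. Let $\phi=(\phi_{j,i})$ be the generic $f\times e$ matrix and $\psi=(\psi_{k,j})$ the generic $g\times f$ matrix, viewed as maps $E\otimes A\xrightarrow{\phi}F\otimes A\xrightarrow{\psi}G\otimes A$. $B=A[a]$ is a polynomial ring in one further indeterminate $a$; as a $\mathrm{GL}(E)\times\mathrm{GL}(F)\times\mathrm{GL}(G)$-representation, $a$ spans $\bigwedge^eE^*\otimes\bigwedge^fF\otimes\bigwedge^gG^*$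 (trivial for the special linear groups). For each partition of $\{1,\dots,f\}$ into $H\sqcup\bar H$ with $|H|=e$, $|\bar H|=g$, let $\nabla_{\bar H,H}$ be the sign of the permutation arranging the elements of $\bar H,H$ (the elements of $\bar H$ followed by those of $H$, each in increasing order) into increasing order, $\phi(H)$ the submatrix of $\phi$ consisting of the rows in $H$, and $\psi(\bar H)$ the submatrix of $\psi$ consisting of the columns in $\bar H$. Then $$J=I_1(\psi\phi)+\bigl(\det\psi(\bar H)+\nabla_{\bar H,H}\,a\det\phi(H)\ :\ H\sqcup\bar H=\{1,\dots,f\},\ |H|=e,\ |\bar H|=g\bigr)\subset B,$$ where $I_1(\psi\phi)$ is the ideal generated by the entries of $\psi\phi$, and $I=I_1(\psi\phi)+I_g(\psi)\subset A$, where $I_g(\psi)$ is generated by the $g\times g$ minors of $\psi$ (so $A/I\cong B/(J+aB)$). $B$ is bigraded by $\deg\phi_{j,i}=(1,0)$, $\deg\psi_{k,j}=(0,1)$, $\deg a=(-e,g)$; $J$ is bihomogeneous; $A=B/aB$ inherits the bigrading. $\mathbf K$ is regarded as the quotient of $A$ (resp. $B$) by the ideal generated by all the variables. *)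

(* Defs.v *)
From HB Require Import structures.
From mathcomp Require Import all_boot all_order all_fingroup all_algebra.
From mathcomp Require Import ring_quotient generic_quotient mpoly.

Set Implicit Arguments.
Unset Strict Implicit.
Unset Printing Implicit Defensive.

Import GRing.Theory.

Local Open Scope ring_scope.
Local Open Scope quotient_scope.

Definition ideal_gen (R : comNzRingType) (S : R -> Prop) (x : R) : Prop :=
  exists (k : nat) (c s : 'I_k -> R),
    (forall i, S (s i)) /\ x = \sum_(i < k) c i * s i.

(** * Quotient of a vector space by a subspace *)

Section VectorQuotient.
Variables (K : fieldType) (V : vectType K) (U : {vspace V}).

Definition vquot : Type := Quotient.quot (pred_of_vspace U).

HB.instance Definition _ := GRing.Zmodule.on vquot.
HB.instance Definition _ := EqQuotient.on vquot.

Definition vquot_class (v : V) : vquot := \pi_vquot v.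
Definition vquot_scale (c : K) : vquot -> vquot := lift_op1 vquot ( *:%R c).

Lemma vquot_eqP (u v : V) :
  reflect (vquot_class u = vquot_class v) (u - v \in U).
Proof.
have -> : (u - v \in U) = (\pi_vquot u == \pi_vquot v).
  exact: (Quotient.idealrBE (pred_of_vspace U)).
exact: eqP.
Qed.

Lemma vquot_classD u v : vquot_class (u + v) = vquot_class u + vquot_class v.
Proof. exact: (pi_addr (s := Quotient.quot (pred_of_vspace U))). Qed.

Lemma vquot_classP (x : vquot) : exists v, x = vquot_class v.
Proof. by exists (repr x); rewrite /vquot_class reprK. Qed.

Lemma vquot_classZ c v : vquot_class (c *: v) = vquot_scale c (vquot_class v).
Proof.
rewrite /vquot_scale; unlock; apply/vquot_eqP; rewrite -scalerBr memvZ //.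
by apply/vquot_eqP; rewrite /vquot_class reprK.
Qed.

Fact vquot_scaleA a b v :
  vquot_scale a (vquot_scale b v) = vquot_scale (a * b) v.
Proof.
by have [u ->] := vquot_classP v; rewrite -!vquot_classZ scalerA.
Qed.

Fact vquot_scale1 : left_id 1 vquot_scale.
Proof. by move=> v; have [u ->] := vquot_classP v; rewrite -vquot_classZ scale1r. Qed.

Fact vquot_scaleDr : right_distributive vquot_scale +%R.
Proof.
move=> a x y; have [u ->] := vquot_classP x; have [v ->] := vquot_classP y.
by rewrite -vquot_classD -!vquot_classZ scalerDr vquot_classD.
Qed.

Fact vquot_scaleDl v : {morph vquot_scale^~ v : a b / a + b}.
Proof.
move=> a b; have [u ->] := vquot_classP v.
by rewrite -!vquot_classZ scalerDl vquot_classD.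
Qed.

HB.instance Definition _ := GRing.Zmodule_isLmodule.Build K vquot
  vquot_scaleA vquot_scale1 vquot_scaleDr vquot_scaleDl.

End VectorQuotient.

(** * Bigraded Tor over a polynomial ring *)

Definition bidegree : zmodType := (int * int)%type.

Section Tor.
Variables (K : fieldType) (N : nat) (w : 'rV[bidegree]_N).
Local Notation R := {mpoly K[N]}.

Definition bihomog (d : bidegree) (p : R) : Prop :=
  forall m, m \in msupp p -> \sum_(i < N) w 0 i *+ m i = d.

(* A resolution of R/I by bigraded free R-modules of finite rank.  The n-th
   module is 'rV[R]_(rank n), its k-th basis vector has bidegree deg k, and
   matrices act on the right.  The augmentation to R/I is v |-> v *m aug mod I.
   Such resolutions exist for every bihomogeneous ideal, since R is noetherian,
   and Tor does not depend on the one chosen. *)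
Record free_resolution (I : R -> Prop) := FreeResolution {
  rank : nat -> nat;
  deg : forall n, 'I_(rank n) -> bidegree;
  diff : forall n, 'M[R]_(rank n.+1, rank n);
  aug : 'cV[R]_(rank 0);
  diff_bihomog : forall n j k, bihomog (deg j - deg k) (diff n j k);
  aug_bihomog : forall k, bihomog (deg k) (aug k 0);
  aug_surj : exists v : 'rV_(rank 0), I ((v *m aug) 0 0 - 1);
  aug_exact : forall v : 'rV_(rank 0),
    I ((v *m aug) 0 0) <-> exists u, v = u *m diff 0;
  diff_exact : forall n (v : 'rV_(rank n.+1)),
    v *m diff n = 0 <-> exists u, v = u *m diff n.+1
}.

Variables (I : R -> Prop) (P : free_resolution I).

(* The base change - (x)_R K along R -> R/(variables) = K: since the modules
   are free with given bases, it replaces each entry by its constant term. *)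
Definition fiber m n (M : 'M[R]_(m, n)) : 'M[K]_(m, n) :=
  map_mx (mcoeff 0%MM) M.

Definition Tor_cycles (i : nat) : {vspace 'rV[K]_(rank P i)} :=
  match i return {vspace 'rV[K]_(rank P i)} with
  | 0 => fullv
  | n.+1 => lker (linfun (mulmxr (fiber (diff P n))))
  end.

Definition Tor_boundaries (i : nat) : {vspace subvs_of (Tor_cycles i)} :=
  (linfun vsval @^-1: limg (linfun (mulmxr (m := 1) (fiber (diff P i)))))%VS.

Definition Tor (i : nat) : lmodType K := vquot (Tor_boundaries i).

Definition Tor_class i (z : subvs_of (Tor_cycles i)) : Tor i :=
  vquot_class (Tor_boundaries i) z.

(* The component of Tor of bidegree d. *)
Definition Tor_bideg i (d : bidegree) (x : Tor i) : Prop :=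
  exists2 z, x = Tor_class z &
    forall k, deg k != d -> vsval z 0 k = 0.

(* A lift to P of the map R/I -> R/I induced by a ring endomorphism s of R
   with s(I) <= I.  Its n-th component is the s-semilinear map
   v |-> s(v) *m T n. *)
Definition semilinear_lift (s : R -> R)
    (T : forall n, 'M[R]_(rank P n)) : Prop :=
  (forall k, I ((T 0%N *m aug P) k 0 - s (aug P k 0))) /\
  (forall n, map_mx s (diff P n) *m T n = T n.+1 *m diff P n).

(* The graph of the endomorphism of Tor_i(R/I, K) induced by s, where s is
   K-linear and preserves I and constant terms, hence acts on K as the identity.
   By the comparison theorem a lift exists and is unique up to homotopy, so this
   is the graph of a function, independent of T. *)
Definition Tor_action (s : R -> R) i (x y : Tor i) : Prop :=
  exists2 T, semilinear_lift s T &
    exists z z' : subvs_of (Tor_cycles i),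
      [/\ x = Tor_class z, y = Tor_class z' &
          vsval z' = vsval z *m fiber (T i)].

Definition subst (v : 'rV[R]_N) (p : R) : R :=
  p \mPo [tuple v 0 i | i < N].

End Tor.

(** * The ideals I and J *)

Section Complement.
Variables (f : nat) (H : {set 'I_f}).

Definition arrangement : seq 'I_f := enum (~: H) ++ enum H.

Lemma size_arrangement : size arrangement = f.
Proof. by rewrite size_cat -!cardE addnC cardsC card_ord. Qed.

Definition arrangement_fun (k : 'I_f) : 'I_f := nth k arrangement k.

Lemma arrangement_fun_inj : injective arrangement_fun.
Proof.
have uA : uniq arrangement.
  rewrite cat_uniq !enum_uniq andbT /=; apply/hasPn => x.
  by rewrite !mem_enum inE negbK.
move=> j k /eqP; rewrite /arrangement_fun.
rewrite (set_nth_default k) ?size_arrangement // nth_uniq ?size_arrangement //.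
by move/eqP/val_inj.
Qed.

Definition nabla_perm : 'S_f := perm arrangement_fun_inj.
End Complement.

Section Ideals.
Variables (e f g : nat) (R : comNzRingType).

(* phi(H) and psi(H); enum_val lists a set of ordinals in increasing order. *)
Definition row_minor (phi : 'M[R]_(f, e)) (H : {set 'I_f}) (cH : #|H| = e) : R :=
  \det (rowsub (fun i => enum_val (cast_ord (esym cH) i)) phi).

Definition col_minor (psi : 'M[R]_(g, f)) (H : {set 'I_f}) (cH : #|H| = g) : R :=
  \det (colsub (fun i => enum_val (cast_ord (esym cH) i)) psi).

Definition idealI (phi : 'M[R]_(f, e)) (psi : 'M[R]_(g, f)) : R -> Prop :=
  ideal_gen (fun p =>
    (exists k i, p = (psi *m phi) k i) \/
    (exists (H : {set 'I_f}) (cH : #|H| = g), p = col_minor psi cH)).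

Definition idealJ (phi : 'M[R]_(f, e)) (psi : 'M[R]_(g, f)) (a : R) : R -> Prop :=
  ideal_gen (fun p =>
    (exists k i, p = (psi *m phi) k i) \/
    (exists (H : {set 'I_f}) (cH : #|H| = e) (cHb : #|~: H| = g),
       p = col_minor psi cHb + (-1) ^+ odd_perm (nabla_perm H) * a * row_minor phi cH)).
End Ideals.

(** * The polynomial rings A and B = A[a] *)

Section PolynomialRings.
Variables (K : fieldType) (e f g : nat).

Definition nA : nat := (f * e + g * f)%N.
Definition nB : nat := (nA + 1)%N.

Definition A := {mpoly K[nA]}.
Definition B := {mpoly K[nB]}.

Definition varA : 'rV[A]_nA := \row_i 'X_i.
Definition phiA : 'M[A]_(f, e) := vec_mx (lsubmx varA).
Definition psiA : 'M[A]_(g, f) := vec_mx (rsubmx varA).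

Definition varB : 'rV[B]_nB := \row_i 'X_i.
Definition phiB : 'M[B]_(f, e) := vec_mx (lsubmx (lsubmx varB)).
Definition psiB : 'M[B]_(g, f) := vec_mx (rsubmx (lsubmx varB)).
Definition aB : B := rsubmx varB 0 0.

Definition wA : 'rV[bidegree]_nA :=
  row_mx (const_mx (1, 0)) (const_mx (0, 1)).
Definition wB : 'rV[bidegree]_nB :=
  row_mx wA (const_mx (- e%:Z, g%:Z)).

(* phi_{j,i} is v_j^* (x) u_i and psi_{k,j} is w_k^* (x) v_j, so a triple
   (al, be, ga) acting on the columns of coordinates of E, F and G sends phi to
   be^-1 phi al and psi to ga^-1 psi be; it fixes a when the three determinants
   are 1. *)
Definition actA (al : 'M[K]_e) (be : 'M[K]_f) (ga : 'M[K]_g) : A -> A :=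
  let c m n (M : 'M[K]_(m, n)) : 'M[A]_(m, n) := map_mx (@mpolyC nA K) M in
  subst (row_mx (mxvec (c _ _ (invmx be) *m phiA *m c _ _ al))
                (mxvec (c _ _ (invmx ga) *m psiA *m c _ _ be))).

Definition actB (al : 'M[K]_e) (be : 'M[K]_f) (ga : 'M[K]_g) : B -> B :=
  let c m n (M : 'M[K]_(m, n)) : 'M[B]_(m, n) := map_mx (@mpolyC nB K) M in
  subst (row_mx (row_mx (mxvec (c _ _ (invmx be) *m phiB *m c _ _ al))
                        (mxvec (c _ _ (invmx ga) *m psiB *m c _ _ be)))
                (const_mx aB)).
End PolynomialRings.

(* Main.v *)
(* Both Tor modules come from the same complex once the variable a is known to
   be a nonzerodivisor on B/J: a bigraded free resolution Q of B/J over B then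
   stays exact modulo a, so Q/aQ is a free resolution of A/I over A with the same
   fiber over K as Q, and the comparison theorem for P and Q/aQ gives the
   isomorphism.  Taking the degree 0 part of the comparison map preserves the
   bidegree; uniqueness up to homotopy of lifts of the group action gives the
   equivariance.

   For f = e + g write Phi(X) = det(psi X) and Psi(X) = det[X | phi] for an
   f x g matrix X; on the unit matrices E_S these are the minors det psi(S) and
   the signed complementary minors of phi, so that J is I_1(psi phi) together
   with all Phi(X) + a Psi(X).  Regularity of a amounts to lifting the relations
   between the generators of I = J mod a, that is, to the implication
   sum c_S Phi(E_S) = 0 => sum c_S Psi(E_S) = 0 modulo I_1(psi phi).  Modulo
   I_1(psi phi), with T the first g indices, one has
   Phi(E_T) Psi(X) = Psi(E_T) Phi(X), so it suffices that Phi(E_T) is a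
   nonzerodivisor modulo I_1(psi phi).  This holds because, for a suitable weight
   of the variables, Phi(E_T) and the entries of psi phi have pairwise coprime
   leading monomials, whence all their syzygies are Koszul. *)

Require Import Defs.
From HB Require Import structures.
From mathcomp Require Import all_boot all_order all_fingroup all_algebra mpoly.
From mathcomp Require Import zify ring.

Set Implicit Arguments.
Unset Strict Implicit.
Unset Printing Implicit Defensive.

Import Order.TTheory GRing.Theory Num.Theory.

Local Open Scope ring_scope.

(** * Weighted homogeneous components *)

Section Weights.
Variables (K : fieldType) (N : nat) (W : zmodType) (w : 'I_N -> W).
Local Notation R := {mpoly K[N]}.

(** The weights lie in an arbitrary abelian group: bidegrees for the grading of Tor, integers for
    the choice of leading monomials. *)
Definition mwt (m : 'X_{1..N}) : W := \sum_(i < N) w i *+ m i.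

Definition whomog (d : W) (p : R) : Prop := forall m, m \in msupp p -> mwt m = d.

Definition hcomp (d : W) (p : R) : R :=
  \sum_(m <- msupp p | mwt m == d) p@_m *: 'X_[m].

Lemma mwtD m1 m2 : mwt (m1 + m2)%MM = mwt m1 + mwt m2.
Proof. by rewrite /mwt -big_split; apply: eq_bigr => i _; rewrite mnmDE mulrnDr. Qed.

Lemma mwt0 : mwt 0%MM = 0.
Proof. by rewrite /mwt big1 // => i _; rewrite mnm0E. Qed.

Lemma mwtU i : mwt U_(i)%MM = w i.
Proof.
rewrite /mwt (bigD1 i) //= mnm1E eqxx big1 ?addr0 // => j ji.
by rewrite mnm1E eq_sym (negPf ji).
Qed.

Lemma mcoeff_hcomp d p m : (hcomp d p)@_m = if mwt m == d then p@_m else 0.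
Proof.
rewrite /hcomp -big_filter raddf_sum /=.
under eq_bigr do rewrite mcoeffZ mcoeffX.
have [dm|dm] := boolP (m \in [seq u <- msupp p | mwt u == d]).
  rewrite (bigD1_seq m) ?filter_uniq ?msupp_uniq //= eqxx mulr1 big1 ?addr0.
    by move: dm; rewrite mem_filter => /andP[->].
  by move=> u /negPf ->; rewrite mulr0.
rewrite big_seq big1 => [|u uF].
  case: eqP => // dm'; move: dm; rewrite mem_filter dm' eqxx /=.
  by move/memN_msupp_eq0.
by case: eqP => [E|]; rewrite ?mulr0 //; case/negP: dm; rewrite -E.
Qed.

Lemma hcomp_is_linear d : linear (hcomp d).
Proof.
move=> c p q; apply/mpolyP => m.
rewrite mcoeffD mcoeffZ !mcoeff_hcomp mcoeffD mcoeffZ.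
by case: ifP => _ //; rewrite mulr0 addr0.
Qed.

HB.instance Definition _ d :=
  GRing.isLinear.Build K R R _ (hcomp d) (hcomp_is_linear d).

Lemma hcomp_homog d p : whomog d (hcomp d p).
Proof.
by move=> m; rewrite mcoeff_msupp mcoeff_hcomp; case: (mwt m =P d) => // _; rewrite eqxx.
Qed.

Lemma hcompX d m : hcomp d 'X_[m] = if mwt m == d then 'X_[m] else 0.
Proof.
apply/mpolyP => u; rewrite mcoeff_hcomp mcoeffX.
case: (m =P u) => [->|/eqP mu]; first by case: ifP => _; rewrite ?mcoeffX ?eqxx ?mcoeff0.
by case: (mwt m == d); case: ifP; rewrite ?mcoeffX ?(negPf mu) ?mcoeff0.
Qed.

Lemma hcompMX d p m : hcomp d (p * 'X_[m]) = hcomp (d - mwt m) p * 'X_[m].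
Proof.
rewrite [p]mpolyE mulr_suml !linear_sum /= mulr_suml; apply: eq_bigr => u _.
rewrite -scalerAl -mpolyXD !linearZ /= !hcompX mwtD.
rewrite (can2_eq (addrK _) (subrK _)) -scalerAl; case: ifP => _.
  by rewrite mpolyXD.
by rewrite mul0r.
Qed.

(** This is how bihomogeneous generators give a graded ideal, and how chain maps are cut down to
    their degree 0 part. *)
Lemma hcompM d c p q : whomog c q -> hcomp d (p * q) = hcomp (d - c) p * q.
Proof.
move=> hq; rewrite [in LHS](mpolyE q) [in RHS](mpolyE q) !mulr_sumr linear_sum /=.
rewrite !big_seq; apply: eq_bigr => m mq.
by rewrite -!scalerAr linearZ /= hcompMX hq.
Qed.

Lemma hcomp_id d p : whomog d p -> hcomp d p = p.
Proof.
move=> hp; apply/mpolyP => m; rewrite mcoeff_hcomp; case: ifP => // /negP dm.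
by rewrite memN_msupp_eq0 //; apply/negP => /hp dm'; apply: dm; rewrite dm'.
Qed.

Lemma whomogP d p : whomog d p <-> hcomp d p = p.
Proof. by split=> [/hcomp_id //|<-]; exact: hcomp_homog. Qed.

Lemma whomog0 d : whomog d 0.
Proof. by apply/whomogP; rewrite linear0. Qed.

Lemma whomogC c : whomog 0 c%:MP.
Proof.
move=> m; rewrite msuppC; case: ifP => // _; rewrite inE => /eqP ->; exact: mwt0.
Qed.

Lemma whomogX m : whomog (mwt m) 'X_[m].
Proof. by move=> u; rewrite msuppX inE => /eqP ->. Qed.

Lemma whomogXU i : whomog (w i) 'X_i.
Proof. by rewrite -mwtU; exact: whomogX. Qed.

Lemma whomogD d p q : whomog d p -> whomog d q -> whomog d (p + q).
Proof. by move=> /whomogP hp /whomogP hq; apply/whomogP; rewrite linearD /= hp hq. Qed.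

Lemma whomogN d p : whomog d p -> whomog d (- p).
Proof. by move=> /whomogP hp; apply/whomogP; rewrite linearN /= hp. Qed.

Lemma whomogZ c d p : whomog d p -> whomog d (c *: p).
Proof. by move=> /whomogP hp; apply/whomogP; rewrite linearZ /= hp. Qed.

Lemma whomogM c d p q : whomog c p -> whomog d q -> whomog (c + d) (p * q).
Proof.
by move=> /whomogP hp hq; apply/whomogP; rewrite (hcompM _ _ hq) addrK hp.
Qed.

Lemma whomog_sum (I : Type) (r : seq I) (P : pred I) d (F : I -> R) :
  (forall i, P i -> whomog d (F i)) -> whomog d (\sum_(i <- r | P i) F i).
Proof. by move=> h; elim/big_ind: _ => //; [exact: whomog0 | exact: whomogD]. Qed.

Lemma whomog_prod (I : Type) (r : seq I) (P : pred I) (d : I -> W) (F : I -> R) :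
  (forall i, P i -> whomog (d i) (F i)) ->
  whomog (\sum_(i <- r | P i) d i) (\prod_(i <- r | P i) F i).
Proof.
move=> h; elim/big_ind2: _ => //; first by rewrite -mpolyC1; exact: whomogC.
by move=> *; exact: whomogM.
Qed.

Lemma whomog_sign d (b : bool) p : whomog d p -> whomog d ((-1) ^+ b * p).
Proof. by move=> h; rewrite mulr_sign; case: b => //; exact: whomogN. Qed.

End Weights.

(** * Syzygies of polynomials with coprime leading monomials *)

(** The terms at (i, j) and (j, i) cancel. The diagonal is a separate hypothesis, since 2 may be a
    zero divisor. *)
Lemma alternating_sum (R : comNzRingType) (I : finType) (S : I -> I -> R) (F : I -> R) :
  (forall i, S i i = 0) -> (forall i j, S i j = - S j i) ->
  \sum_i (\sum_j S i j * F j) * F i = 0.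
Proof.
move=> S0 SN; under eq_bigr do rewrite mulr_suml.
(* A finite type has no order of its own; [enum_rank] selects one pair out of each couple. *)
rewrite pair_big /= (bigID (fun p : I * I => enum_rank p.1 < enum_rank p.2)%N) /=.
rewrite addrC (bigID (fun p : I * I => p.1 == p.2)) /=.
rewrite big1 ?add0r => [|[i j] /= /andP[_ /eqP ->]]; last by rewrite S0 !mul0r.
rewrite [X in _ + X](reindex_inj (h := fun p : I * I => (p.2, p.1))) /=; last first.
  by move=> [i j] [k l] [-> ->].
rewrite -[X in _ + X]opprK -sumrN; apply/eqP; rewrite subr_eq0; apply/eqP.
apply: eq_big => [[i j]|[i j] _] /=; last by rewrite SN !mulNr mulrAC.
by rewrite -leqNgt ltn_neqAle andbC eq_sym (inj_eq val_inj) (inj_eq enum_rank_inj) eq_sym.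
Qed.

Section CoprimeLeads.
Variables (K : fieldType) (N : nat) (I : finType).
Local Notation R := {mpoly K[N]}.
Variable m : I -> 'X_{1..N}.
Hypothesis cop : forall i j, i != j -> forall x, m i x = 0%N \/ m j x = 0%N.

Lemma lem_coprime i j u : i != j -> (m i <= u + m j)%MM -> (m i <= u)%MM.
Proof.
move=> ij /mnm_lepP le; apply/mnm_lepP => x; have := le x; rewrite mnmDE.
by case: (cop ij x) => ->; rewrite ?addn0.
Qed.

(** By induction on [s]: the terms divisible by the head monomial are charged to it, and all others
    are divisible by a monomial of the tail. *)
Lemma monomial_span (s : seq I) (q : R) : uniq s ->
  (forall u, u \in msupp q -> exists2 j, j \in s & (m j <= u)%MM) ->
  exists c : I -> R, q = \sum_(j <- s) c j * 'X_[m j].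
Proof.
elim: s q => [|x s IH] q /= => [_|/andP[xs us]] h.
  exists (fun=> 0); rewrite big_nil; apply: msuppnil0.
  by case E: (msupp q) => [//|u l]; case: (h u); rewrite ?E ?mem_head.
pose q2 := \sum_(u <- msupp q | ~~ (m x <= u)%MM) q@_u *: 'X_[u].
have [c2 E2] : exists c, q2 = \sum_(j <- s) c j * 'X_[m j].
  apply: IH => // u /msupp_sum_le /flattenP[l /mapP[v]].
  rewrite mem_filter => /andP[xv vq] -> /msuppZ_le; rewrite msuppX inE => /eqP ->.
  have [j] := h _ vq; rewrite inE => /orP[/eqP ->|js jv]; last by exists j.
  by rewrite (negPf xv).
pose d := \sum_(u <- msupp q | (m x <= u)%MM) q@_u *: 'X_[u - m x] : R.
exists (fun j => if j == x then d else c2 j); rewrite big_cons eqxx.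
rewrite [LHS]mpolyE (bigID (fun u => (m x <= u)%MM)) /= -/q2 E2; congr (_ + _).
  rewrite /d mulr_suml; apply: eq_bigr => u xu.
  by rewrite -scalerAl -mpolyXD submK.
rewrite !big_seq; apply: eq_bigr => j js.
by case: eqP => // E; rewrite -E js in xs.
Qed.

(** Pairwise coprime monomials form a regular sequence, so their syzygies are Koszul; the matrix [S]
    records the Koszul coefficients. *)
Lemma monomial_syzygy (s : seq I) (q : I -> R) : uniq s ->
  \sum_(i <- s) q i * 'X_[m i] = 0 ->
  exists S : I -> I -> R, [/\ forall i, S i i = 0, forall i j, S i j = - S j i &
    forall i, i \in s -> q i = \sum_(j <- s) S i j * 'X_[m j]].
Proof.
elim: s q => [|x s IH] q /= => [_ _|/andP[xs us]].
  by exists (fun _ _ => 0); split=> // *; rewrite oppr0.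
rewrite big_cons => E.
have [c Ec] : exists c : I -> R, q x = \sum_(j <- s) c j * 'X_[m j].
  apply: monomial_span => // u uq.
  have : (u + m x)%MM \in msupp (- \sum_(i <- s) q i * 'X_[m i]).
    by rewrite -[X in msupp (- X)](addKr (q x * 'X_[m x])) E addr0 opprK
               mcoeff_msupp addmC mcoeffMX -mcoeff_msupp.
  rewrite (perm_mem (msuppN _)) => /msupp_sum_le /flattenP[l /mapP[j]].
  rewrite mem_filter /= => js ->; rewrite (perm_mem (msuppMX _ _)) => /mapP[v _ Ev].
  exists j => //; apply: (@lem_coprime j x); last by rewrite Ev lem_addr.
  by apply: contraNneq xs => <-.
(* Subtracting the Koszul relations between [x] and the j in [s], with coefficients [c j], clears
   the entry at [x] and leaves a syzygy of the tail. *)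
have [|S [S0 SN SE]] := IH (fun i => q i + c i * 'X_[m x]) us.
  rewrite -[RHS]E Ec mulr_suml -big_split; apply: eq_bigr => i _ /=.
  by rewrite mulrDl addrC mulrAC.
exists (fun i j => if i == x then (if j == x then 0 else c j)
                   else if j == x then - c i else S i j); split.
- by move=> i; rewrite S0; case: eqP.
- by move=> i j; do 2 case: eqP => _; rewrite ?opprK ?oppr0 // SN.
move=> i; rewrite inE big_cons eqxx; case: eqP => [-> _|_ /= i_s].
  rewrite mul0r add0r Ec !big_seq; apply: eq_bigr => j js.
  by case: eqP => // E'; rewrite -E' js in xs.
have /= := SE i i_s; move/(canRL (addrK _)) ->; rewrite addrC mulNr; congr (_ + _).
rewrite !big_seq; apply: eq_bigr => j js.
by case: eqP => // E'; rewrite -E' js in xs.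
Qed.

(** * Polynomials with coprime leading monomials for an integer weight *)

Variable w : 'I_N -> int.
Hypothesis w_ge0 : forall i, 0 <= w i.

Definition wt_lt (d : int) (p : R) : Prop := forall u, u \in msupp p -> mwt w u < d.

Lemma mwt_ge0 u : 0 <= mwt w u.
Proof. by apply: sumr_ge0 => i _; rewrite mulrn_wge0. Qed.

Lemma wt_ltD d p q : wt_lt d p -> wt_lt d q -> wt_lt d (p + q).
Proof.
by move=> hp hq u /msuppD_le; rewrite mem_cat => /orP[/hp|/hq].
Qed.

Lemma wt_ltN d p : wt_lt d p -> wt_lt d (- p).
Proof. by move=> hp u; rewrite (perm_mem (msuppN _)) => /hp. Qed.

Lemma wt_lt_sum (J : Type) (r : seq J) d (F : J -> R) :
  (forall i, wt_lt d (F i)) -> wt_lt d (\sum_(i <- r) F i).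
Proof.
move=> h; elim/big_ind: _ => //; last exact: wt_ltD.
by move=> u; rewrite msupp0.
Qed.

Lemma wt_ltM c d p q : wt_lt (c + 1) p -> wt_lt d q -> wt_lt (c + d) (p * q).
Proof.
move=> hp hq u /msuppM_le /allpairsP[[u1 u2] /= [/hp h1 /hq h2 ->]].
by rewrite mwtD ler_ltD // -ltzD1.
Qed.

Lemma hcomp_wt_lt d p : wt_lt d p -> hcomp w d p = 0.
Proof.
move=> hp; apply/mpolyP => u; rewrite mcoeff_hcomp mcoeff0; case: eqP => // E.
by apply: memN_msupp_eq0; apply/negP => /hp; rewrite E ltxx.
Qed.

Lemma homog_wt_lt d p : whomog w d p -> wt_lt (d + 1) p.
Proof. by move=> h u /h ->; rewrite ltrDl. Qed.

Lemma wt_lt_tail d p : wt_lt (d + 1) p -> wt_lt d (p - hcomp w d p).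
Proof.
move=> hp u; rewrite mcoeff_msupp mcoeffB mcoeff_hcomp.
case: (mwt w u =P d) => [_|/eqP nd]; first by rewrite subrr eqxx.
by rewrite subr0 -mcoeff_msupp => /hp; rewrite ltzD1 lt_neqAle nd.
Qed.

Lemma wt_lt_bound p : exists n : nat, wt_lt n%:Z p.
Proof.
elim/mpolyind: p => [|c u p _ _ [n hn]]; first by exists 0%N => u; rewrite msupp0.
exists (n + `|mwt w u|.+1)%N => v /msuppD_le; rewrite mem_cat => /orP[|/hn h].
  move/msuppZ_le; rewrite msuppX inE => /eqP ->.
  by rewrite PoszD -addn1 PoszD gez0_abs ?mwt_ge0 // addrA ltzD1 lerDr.
by apply: lt_le_trans h _; rewrite lez_nat leq_addr.
Qed.

Variables G L : I -> R.
Hypothesis GE : forall i, G i = 'X_[m i] + L i.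
Hypothesis L_lt : forall i, wt_lt (mwt w (m i)) (L i).

(** Induction on a strict bound n for the weight of all products of [q i] with its leading monomial.
    The top components form a syzygy of the monomials; subtracting the Koszul syzygy with the same
    coefficients lowers the bound. *)
Lemma koszul_syzygy_rec (n : nat) (q : I -> R) :
  (forall i, wt_lt (n%:Z - mwt w (m i)) (q i)) -> \sum_i q i * G i = 0 ->
  exists S : I -> I -> R, [/\ forall i, S i i = 0, forall i j, S i j = - S j i &
    forall i, q i = \sum_j S i j * G j].
Proof.
elim: n q => [|n IH] q hq sq.
  (* With bound 0 a monomial of [q i] would have negative weight, so [q i] vanishes. *)
  exists (fun _ _ => 0); split=> [//|i j|i]; rewrite ?oppr0 //.
  rewrite big1 => [|j _]; last by rewrite mul0r.
  apply: msuppnil0; case E: (msupp (q i)) => [//|u l].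
  have := hq i u; rewrite E mem_head => /(_ isT).
  by rewrite sub0r ltNge lerNl => /negP []; rewrite (@le_trans _ _ 0) // ?oppr_le0 mwt_ge0.
pose t i := hcomp w (n%:Z - mwt w (m i)) (q i).
pose r i := q i - t i.
have hr i : wt_lt (n%:Z - mwt w (m i)) (r i).
  by apply: wt_lt_tail => u /hq; rewrite -addn1 PoszD addrAC.
have [|S [S0 SN SE]] := @monomial_syzygy (index_enum I) t (index_enum_uniq _).
  transitivity (hcomp w n (\sum_i q i * G i)); last by rewrite sq linear0.
  rewrite linear_sum /=; apply: eq_bigr => i _.
  rewrite GE mulrDr linearD /= hcompMX [X in _ + X]hcomp_wt_lt ?addr0 //.
  rewrite -[n%:Z](subrK (mwt w (m i))); apply: (wt_ltM _ (@L_lt i)) => u /hq.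
  by rewrite -addn1 PoszD addrAC.
(* Only the homogeneous part of [S] of the right weight is kept. This weight is symmetric in i and
   j, so the part is still alternating. *)
pose T i j := hcomp w (n%:Z - mwt w (m i) - mwt w (m j)) (S i j).
have T0 i : T i i = 0 by rewrite /T S0 linear0.
have TN i j : T i j = - T j i by rewrite /T SN linearN /= addrAC.
have tE i : t i = \sum_j T i j * 'X_[m j].
  rewrite /t -[LHS](hcomp_id (@hcomp_homog _ _ _ w _ _)) -/(t i) SE ?mem_index_enum //.
  by rewrite linear_sum; apply: eq_bigr => j _; rewrite /= hcompMX.
have [||S2 [S20 S2N S2E]] := IH (fun i => q i - \sum_j T i j * G j).
(* The top component [t i] cancels against the leading monomials, leaving the tail of [q i] and
   products with the tails [L j], all of smaller weight. *)
- move=> i; have -> : q i - \sum_j T i j * G j = r i - \sum_j T i j * L j.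
    rewrite /r tE -addrA -opprD -big_split; congr (_ - _); apply: eq_bigr => j _.
    by rewrite GE mulrDr.
  apply: wt_ltD; first exact: hr.
  apply/wt_ltN/wt_lt_sum => j.
  rewrite -[X in wt_lt X](subrK (mwt w (m j))); apply: (wt_ltM _ (@L_lt j)).
  by apply: homog_wt_lt; exact: hcomp_homog.
- under eq_bigr do rewrite mulrBl.
  by rewrite sumrB sq (alternating_sum _ T0 TN) subrr.
exists (fun i j => T i j + S2 i j); split=> [i|i j|i].
- by rewrite T0 S20 addr0.
- by rewrite TN S2N opprD.
- under eq_bigr do rewrite mulrDl.
  by rewrite big_split /= -S2E addrC subrK.
Qed.

Lemma koszul_syzygy (q : I -> R) : \sum_i q i * G i = 0 ->
  exists S : I -> I -> R, [/\ forall i, S i i = 0, forall i j, S i j = - S j i &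
    forall i, q i = \sum_j S i j * G j].
Proof.
have [b hb] := fin_all_exists (fun i => wt_lt_bound (q i)).
(* The sum over all i is one starting bound that dominates each individual one. *)
move=> sq; apply: (@koszul_syzygy_rec (\sum_i (b i + `|mwt w (m i)|))%N) => // i u /hb h.
apply: lt_le_trans h _; rewrite lerBrDr -[mwt w _]gez0_abs ?mwt_ge0 //.
by rewrite -PoszD lez_nat (bigD1 i) //= leq_addr.
Qed.

End CoprimeLeads.

(** * Ideals given by generators *)

Section IdealGen.
Variables (R : comNzRingType) (S : R -> Prop).

Lemma ideal_gen_mem c s : S s -> ideal_gen S (c * s).
Proof. by move=> Ss; exists 1%N, (fun=> c), (fun=> s); rewrite big_ord1. Qed.

Lemma ideal_gen0 : ideal_gen S 0.
Proof.
exists 0%N, (fun=> 0), (fun=> 0).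
by split=> [[]//|]; rewrite big_ord0.
Qed.

Lemma ideal_genD x y : ideal_gen S x -> ideal_gen S y -> ideal_gen S (x + y).
Proof.
move=> [k [c [s [Ss ->]]]] [l [d [t [St ->]]]].
exists (k + l)%N, (fun i => match split i with inl j => c j | inr j => d j end),
  (fun i => match split i with inl j => s j | inr j => t j end).
split=> [i|]; first by case: (split i).
rewrite big_split_ord /=; congr (_ + _); apply: eq_bigr => i _.
  by rewrite (unsplitK (inl i)).
by rewrite (unsplitK (inr i)).
Qed.

Lemma ideal_genM a x : ideal_gen S x -> ideal_gen S (a * x).
Proof.
move=> [k [c [s [Ss ->]]]]; exists k, (fun i => a * c i), s; split=> //.
by rewrite mulr_sumr; apply: eq_bigr => i _; rewrite mulrA.
Qed.

Lemma ideal_genN x : ideal_gen S x -> ideal_gen S (- x).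
Proof. by rewrite -mulN1r; exact: ideal_genM. Qed.

Lemma ideal_genB x y : ideal_gen S x -> ideal_gen S y -> ideal_gen S (x - y).
Proof. by move=> hx hy; apply: ideal_genD hx (ideal_genN hy). Qed.

Lemma ideal_gen_sum (J : Type) (r : seq J) (P : pred J) (F : J -> R) :
  (forall j, P j -> ideal_gen S (F j)) -> ideal_gen S (\sum_(j <- r | P j) F j).
Proof. by move=> h; elim/big_ind: _ => //; [exact: ideal_gen0|exact: ideal_genD]. Qed.

Lemma ideal_gen_ind (P : R -> Prop) : P 0 -> (forall x y, P x -> P y -> P (x + y)) ->
  (forall c s, S s -> P (c * s)) -> forall x, ideal_gen S x -> P x.
Proof.
move=> P0 PD PS x [k [c [s [Ss ->]]]].
by elim/big_ind: _ => // i _; exact: PS.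
Qed.

End IdealGen.

Lemma ideal_gen_sub (R R' : comNzRingType) (S : R -> Prop) (S' : R' -> Prop)
    (h : {rmorphism R -> R'}) :
  (forall s, S s -> ideal_gen S' (h s)) ->
  forall x, ideal_gen S x -> ideal_gen S' (h x).
Proof.
move=> hS; apply: ideal_gen_ind => [|x y|c s Ss].
- by rewrite rmorph0; exact: ideal_gen0.
- by rewrite rmorphD; exact: ideal_genD.
- by rewrite rmorphM; apply/ideal_genM/hS.
Qed.

Lemma ideal_gen_mono (R : comNzRingType) (S T : R -> Prop) :
  (forall x, S x -> ideal_gen T x) -> forall x, ideal_gen S x -> ideal_gen T x.
Proof. by move=> h; exact: (@ideal_gen_sub _ _ _ _ idfun). Qed.

Lemma ideal_gen_base (R : comNzRingType) (S : R -> Prop) x : S x -> ideal_gen S x.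
Proof. by rewrite -[x in ideal_gen _ x]mul1r; exact: ideal_gen_mem. Qed.

(** In each product of the Leibniz formula the factors are exchanged one at a time. *)
Lemma det_cong (R : comNzRingType) (S : R -> Prop) n (M M' : 'M[R]_n) :
  (forall i j, ideal_gen S (M i j - M' i j)) -> ideal_gen S (\det M - \det M').
Proof.
move=> h; rewrite /determinant -sumrB; apply: ideal_gen_sum => s _.
rewrite -mulrBr; apply: ideal_genM.
elim: (index_enum 'I_n) => [|i r IH]; first by rewrite !big_nil subrr; exact: ideal_gen0.
rewrite !big_cons.
set x := M _ _; set x' := M' _ _; set p := \prod_(_ <- _) _; set p' := \prod_(_ <- _) _.
have -> : x * p - x' * p' = p * (x - x') + x' * (p - p') by ring.
by apply: ideal_genD; apply: ideal_genM => //; exact: h.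
Qed.

(** * The first minor of psi is regular modulo the entries of psi phi *)

Definition ideal1 (e f g : nat) (R : comNzRingType) (phi : 'M[R]_(f, e))
    (psi : 'M[R]_(g, f)) : R -> Prop :=
  ideal_gen (fun p => exists k i, p = (psi *m phi) k i).

Lemma phiAE (K : fieldType) (e f g : nat) j i :
  phiA K e f g j i = 'X_(lshift (g * f) (mxvec_index j i)).
Proof. by rewrite !mxE. Qed.

Lemma psiAE (K : fieldType) (e f g : nat) k j :
  psiA K e f g k j = 'X_(rshift (f * e) (mxvec_index k j)).
Proof. by rewrite !mxE. Qed.

Lemma big_option (V : nmodType) (I : finType) (F : option I -> V) :
  \sum_o F o = F None + \sum_i F (Some i).
Proof.
rewrite (bigD1 None) //= (reindex_omap Some id) => [|[]] //=.
by congr (_ + _); apply: eq_bigl => i; rewrite eqxx.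
Qed.

Section GenericComplex.
Variables (K : fieldType) (e g : nat).
Local Notation f := (g + e)%N.
Local Notation A := (A K e f g).
Local Notation phi := (phiA K e f g).
Local Notation psi := (psiA K e f g).
Local Notation Delta := (\det (lsubmx psi)).

Let x (j : 'I_f) (i : 'I_e) : 'I_(nA e f g) := lshift (g * f) (mxvec_index j i).
Let y (k : 'I_g) (j : 'I_f) : 'I_(nA e f g) := rshift (f * e) (mxvec_index k j).

(* The weight of psi_{k,j} phi_{j,i} is a constant minus (j - (k + i + 1))^2. *)
Definition lead_weight (l : 'I_(nA e f g)) : int :=
  row_mx (mxvec (\matrix_(j < f, i < e) (2 * j * i)%:Z))
         (mxvec (\matrix_(k < g, j < f) ((f * f + 2 * j * k.+1)%:Z - (j * j)%:Z))) 0 l.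

(** The constant f^2 in the weight of psi outweighs -j^2, because j < f. *)
Lemma lead_weight_ge0 l : 0 <= lead_weight l.
Proof.
rewrite /lead_weight mxE; case: (split l) => {}l.
  by case/mxvec_indexP: l => j i; rewrite mxvecE mxE.
case/mxvec_indexP: l => k j; rewrite mxvecE mxE.
have := ltn_ord j; nia.
Qed.

Lemma lead_weight_phi j i : lead_weight (x j i) = (2 * j * i)%:Z.
Proof. by rewrite /lead_weight row_mxEl mxvecE mxE. Qed.

Lemma lead_weight_psi k j :
  lead_weight (y k j) = (f * f + 2 * j * k.+1)%:Z - (j * j)%:Z.
Proof. by rewrite /lead_weight row_mxEr mxvecE mxE. Qed.

(** In the entry (k, i) of psi phi the weight of the j-th summand is largest at j = k + i + 1, which
    is thus a legitimate index. *)
Lemma mid_subproof (p : 'I_g * 'I_e) : (p.1 + p.2 + 1 < f)%N.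
Proof. by have := ltn_ord p.1; have := ltn_ord p.2; lia. Qed.

Let mid p : 'I_f := Ordinal (mid_subproof p).

Let lead (o : option ('I_g * 'I_e)) : 'X_{1..nA e f g} :=
  if o is Some p then (U_(y p.1 (mid p)) + U_(x (mid p) p.2))%MM
  else (\sum_(k < g) U_(y k (lshift e k)))%MM.

Let gen (o : option ('I_g * 'I_e)) : A :=
  if o is Some p then (psi *m phi) p.1 p.2 else Delta.

Lemma mxvec_index_eq m n (j j' : 'I_m) (i i' : 'I_n) :
  (mxvec_index j i == mxvec_index j' i') = (j == j') && (i == i').
Proof. by rewrite (inj_eq (@cast_ord_inj _ _ _)) (inj_eq enum_rank_inj) xpair_eqE. Qed.

Lemma phi_index_eq j i j' i' : (x j i == x j' i') = (j == j') && (i == i').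
Proof. by rewrite /x (inj_eq (@lshift_inj _ _)) mxvec_index_eq. Qed.

Lemma psi_index_eq k j k' j' : (y k j == y k' j') = (k == k') && (j == j').
Proof. by rewrite /y (inj_eq (@rshift_inj _ _)) mxvec_index_eq. Qed.

Lemma psi_phi_index_neq k j' j i : (y k j' == x j i) = false.
Proof. by rewrite eq_sym; exact: eq_lrshift. Qed.

(** Either of the variables psi_{k,k+i+1} and phi_{k+i+1,i} determines (k, i). The leading monomial
    of the minor is the diagonal one, and the shift by 1 in k + i + 1 keeps the entries of psi phi
    off that diagonal. *)
Lemma lead_coprime o o' : o != o' -> forall z, lead o z = 0%N \/ lead o' z = 0%N.
Proof.
have SN p z : lead (Some p) z = 0%N \/ lead None z = 0%N.
  rewrite /lead /=.
  case: (boolP [exists k, y k (lshift e k) == z]) => [/existsP[k /eqP <-]|h].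
    left; rewrite mnmDE !mnm1E psi_index_eq [x _ _ == _]eq_sym psi_phi_index_neq -!val_eqE /=.
    by case: eqP => //= pk; case: eqP => //=; lia.
  right; rewrite mnm_sumE big1 // => k _; rewrite mnm1E.
  by move/existsPn: h => /(_ k) /negPf ->.
case: o o' => [p|] [q|] // pq z; last by case: (SN q z); [right|left].
case: (boolP (lead (Some p) z == 0%N)) => [/eqP|]; first by left.
rewrite /lead !mnmDE !mnm1E addn_eq0 !eqb0 negb_and !negbK => h; right.
have neq : (val p.1 == val q.1) && (val (mid p) == val (mid q)) = false /\
           (val (mid p) == val (mid q)) && (val p.2 == val q.2) = false.
  case: p q pq {h} => [k i] [k' i'] /=; rewrite (inj_eq Some_inj) xpair_eqE -!val_eqE /= => h.
  by split; apply: contraNF h; lia.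
case/orP: h => /eqP <-.
  by rewrite ![_ == y p.1 _]eq_sym psi_phi_index_neq psi_index_eq -!val_eqE neq.1.
by rewrite phi_index_eq psi_phi_index_neq -!val_eqE eq_sym [val q.2 == _]eq_sym neq.2.
Qed.

(** Completing the square shows that the chosen term is the unique one of maximal weight, for the
    entries of psi phi and for the minor alike. *)
Lemma gen_lead o : exists2 L, gen o = 'X_[lead o] + L &
  wt_lt lead_weight (mwt lead_weight (lead o)) L.
Proof.
case: o => [p|].
  exists (\sum_(j < f | j != mid p) psi p.1 j * phi j p.2).
    by rewrite /gen mxE (bigD1 (mid p)) //= psiAE phiAE mpolyXD.
  rewrite big_mkcond; apply: wt_lt_sum => j; case: ifP => [jp|_ u]; last by rewrite msupp0.
  rewrite psiAE phiAE -mpolyXD => u; rewrite msuppX inE => /eqP ->.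
  rewrite !mwtD !mwtU !lead_weight_phi !lead_weight_psi /=.
  move: jp; rewrite -val_eqE /=; case: p => k i /=.
  move: (nat_of_ord j) (nat_of_ord k) (nat_of_ord i) => a b c; nia.
pose T (s : 'S_g) : A := (-1) ^+ s * \prod_(k < g) psi k (lshift e (s k)).
have TE (s : 'S_g) : T s = (-1) ^+ s * 'X_[\sum_(k < g) U_(y k (lshift e (s k)))].
  by rewrite /T -mprodXE; congr (_ * _); apply: eq_bigr => k _; rewrite psiAE.
exists (\sum_(s : 'S_g | s != 1%g) T s).
  rewrite /gen /determinant (bigD1 1%g) //= odd_perm1 mul1r; congr (_ + _).
    rewrite /lead -mprodXE; apply: eq_bigr => k _.
    by rewrite perm1 mxE psiAE.
  apply: eq_bigr => s _; congr (_ * _); apply: eq_bigr => k _; by rewrite mxE.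
rewrite big_mkcond; apply: wt_lt_sum => s; case: ifP => [s1|_ u]; last by rewrite msupp0.
rewrite TE mulr_sign => u.
have -> : (u \in msupp (if s then - 'X_[\sum_(k < g) U_(y k (lshift e (s k)))]
     else 'X_[\sum_(k < g) U_(y k (lshift e (s k)))] : A)) =
   (u == \sum_(k < g) U_(y k (lshift e (s k))))%MM.
  by case: (odd_perm s); rewrite ?(perm_mem (msuppN _)) msuppX inE.
move/eqP ->.
(* The weight depends on t only through the sum of (t k - k)^2, since the sum of the t k is the sum
   of the k; the identity is the unique maximum. *)
have wtS (t : 'S_g) : mwt lead_weight (\sum_(k < g) U_(y k (lshift e (t k))))%MM =
   \sum_(k < g) (f * f + k * k)%:Z + \sum_(k < g) (2 * k)%:Z
     - \sum_(k < g) ((t k)%:Z - k%:Z) ^+ 2.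
  rewrite (big_morph _ (@mwtD _ _ _) (@mwt0 _ _ _)).
  rewrite [X in _ + X - _](reindex_inj (@perm_inj _ t)) /= -big_split -sumrB.
  by apply: eq_bigr => k _; rewrite mwtU lead_weight_psi /= expr2; nia.
have := wtS 1%g; under eq_bigr do rewrite perm1; rewrite -/(lead None) => ->.
rewrite wtS ltrD2l [X in _ < - X]big1 => [|k _]; last by rewrite perm1 subrr.
rewrite oppr0 oppr_lt0; have [k sk] : exists k, s k != k.
  apply/existsP; apply: contraNT s1; rewrite negb_exists => /forallP h.
  by apply/eqP/permP => k; rewrite perm1; apply/eqP; have := h k; rewrite negbK.
rewrite (bigD1 k) //= ltr_pwDl ?sumr_ge0 // => [|l _]; last exact: sqr_ge0.
by rewrite exprn_even_gt0 //= subr_eq0 eqz_nat val_eqE.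
Qed.

(** A relation between the minor and the entries of psi phi is Koszul, so the coefficient of the
    minor is a combination of the entries alone: its diagonal Koszul coefficient is 0. *)
Lemma last_minor_regular (q : A) :
  ideal1 phi psi (q * Delta) -> ideal1 phi psi q.
Proof.
move=> hq.
have [c Ec] : exists c : 'I_g * 'I_e -> A, q * Delta = \sum_p c p * (psi *m phi) p.1 p.2.
  move: (q * Delta) hq; apply: ideal_gen_ind => [|u v [c ->] [d ->]|c s [k [i ->]]].
  - by exists (fun=> 0); rewrite big1 // => p _; rewrite mul0r.
  - by exists (fun p => c p + d p); rewrite -big_split; apply: eq_bigr => p _; rewrite mulrDl.
  exists (fun p => if p == (k, i) then c else 0).
  rewrite (bigD1 (k, i)) //= eqxx big1 ?addr0 // => p /negPf ->.
  by rewrite mul0r.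
have [L GE Llt] := fin_all_exists2 gen_lead.
have [|S [S0 _ SE]] := @koszul_syzygy _ _ _ lead lead_coprime lead_weight
   lead_weight_ge0 gen L GE Llt (fun o => if o is Some p then - c p else q).
  by rewrite big_option /= Ec; under [X in _ + X]eq_bigr do rewrite mulNr;
     rewrite sumrN subrr.
rewrite (SE None) big_option S0 mul0r add0r; apply: ideal_gen_sum => p _.
by apply: ideal_gen_mem; exists p.1, p.2.
Qed.
End GenericComplex.

(** * Complementary minors *)

Section ComplementaryMinors.
Variables (R : comNzRingType) (e g : nat).
Local Notation f := (g + e)%N.

Definition unit_cols (h : 'I_g -> 'I_f) : 'M[R]_(f, g) := \matrix_(j, k) (j == h k)%:R.

Lemma mulmx_unit_cols n (M : 'M[R]_(n, f)) h : M *m unit_cols h = colsub h M.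
Proof.
apply/matrixP => i k; rewrite !mxE (bigD1 (h k)) //= !mxE eqxx mulr1 big1 ?addr0 //.
by move=> j /negPf jh; rewrite !mxE jh mulr0.
Qed.

(** Multilinearity in the first g columns. The factor [M] lets one expansion serve both det[X | phi]
    and det(psi X). *)
Lemma det_row_mx_expand (M : 'M[R]_f) (X : 'M[R]_(f, g)) (Z : 'M[R]_(f, e)) :
  \det (row_mx (M *m X) Z) =
  \sum_(h : {ffun 'I_g -> 'I_f}) (\prod_k X (h k) k) * \det (row_mx (M *m unit_cols h) Z).
Proof.
rewrite -[LHS]det_tr [LHS]/determinant.
under [RHS]eq_bigr => h _ do rewrite -det_tr /determinant mulr_sumr.
rewrite exchange_big /=; apply: eq_bigr => s _.
rewrite big_split_ord /=.
under eq_bigr => k _ do rewrite mxE row_mxEl mxE.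
rewrite bigA_distr_bigA mulr_suml mulr_sumr; apply: eq_bigr => h _.
rewrite big_split /= [in RHS]big_split_ord /=.
under [X in _ = _ * (_ * (X * _))]eq_bigr => k _ do
  rewrite mxE row_mxEl mulmx_unit_cols mxE.
set p := \prod_(_ < g) M _ _; set p' := \prod_(_ < g) X _ _.
under [X in _ * (_ * X) = _]eq_bigr => i _ do rewrite mxE row_mxEr.
under [X in _ = _ * (_ * (_ * X))]eq_bigr => i _ do rewrite mxE row_mxEr.
by rewrite [RHS]mulrCA [p' * _]mulrA [p' * p]mulrC.
Qed.

Lemma det_row_mx_mulr (X : 'M[R]_(f, g)) (Z : 'M[R]_(f, e)) (P : 'M[R]_g) (Q : 'M[R]_e) :
  \det (row_mx (X *m P) (Z *m Q)) = \det (row_mx X Z) * (\det P * \det Q).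
Proof.
by rewrite -(det_ublock P 0 Q) -det_mulmx mul_row_block !mulmx0 addr0 add0r.
Qed.

Variables (phi : 'M[R]_(f, e)) (psi : 'M[R]_(g, f)).

Lemma det_mulmx_expand (X : 'M[R]_(f, g)) :
  \det (psi *m X) =
  \sum_(h : {ffun 'I_g -> 'I_f}) (\prod_k X (h k) k) * \det (psi *m unit_cols h).
Proof.
(* Bordering by an identity block turns the minor into a determinant of size f. *)
have E Y : \det (psi *m Y) =
    \det (row_mx ((col_mx psi 0 : 'M_f) *m Y) (col_mx 0 (1%:M : 'M[R]_e))).
  by rewrite mul_col_mx mul0mx -block_mxEh det_ublock det1 mulr1.
by rewrite E det_row_mx_expand; apply: eq_bigr => h _; rewrite E.
Qed.

(* det(psi X) and det[X | phi] are both alternating and multilinear in the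
   columns of X, so it does not matter whether X runs over unit columns only. *)
Definition twisted_minor (a : R) (X : 'M[R]_(f, g)) : R :=
  \det (psi *m X) + a * \det (row_mx X phi).

Lemma twisted_minor_expand a X : twisted_minor a X =
  \sum_(h : {ffun 'I_g -> 'I_f}) (\prod_k X (h k) k) * twisted_minor a (unit_cols h).
Proof.
rewrite /twisted_minor det_mulmx_expand -[X in row_mx X](mul1mx X) det_row_mx_expand.
rewrite mulr_sumr -big_split; apply: eq_bigr => h _ /=.
by rewrite mul1mx mulrDr; congr (_ + _); rewrite mulrCA.
Qed.

Lemma twisted_minorM a X P : twisted_minor a (X *m P) = twisted_minor a X * \det P.
Proof.
rewrite /twisted_minor mulmxA det_mulmx -[X in row_mx _ X](mulmx1 phi) det_row_mx_mulr.
by rewrite det1 mulr1 mulrDl mulrA.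
Qed.

Lemma twisted_minor_noninj a (h : 'I_g -> 'I_f) : ~ injective h ->
  twisted_minor a (unit_cols h) = 0.
Proof.
move=> /injectiveP /injectivePn [k [l kl hkl]].
have z n (M : 'M[R]_n) (k' l' : 'I_n) : k' != l' -> col k' M = col l' M -> \det M = 0.
  move=> kl' E; rewrite -det_tr; apply: determinant_alternate kl' _ => i.
  by move/colP: E => /(_ i); rewrite !mxE.
rewrite /twisted_minor mulmx_unit_cols (z _ _ k l) // ?(z _ _ (lshift e k) (lshift e l)).
- by rewrite mulr0 addr0.
- by rewrite (inj_eq (@lshift_inj _ _)).
- by rewrite !colKl; apply/colP => i; rewrite !mxE hkl.
- by apply/colP => i; rewrite !mxE hkl.
Qed.

Definition set_cols (S : {set 'I_f}) (cS : #|S| = g) (k : 'I_g) : 'I_f :=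
  enum_val (cast_ord (esym cS) k).

(** Sorting the rows by [nabla_perm H] makes the matrix block upper triangular, with diagonal blocks
    1 and phi(H). *)
Lemma det_row_mx_set_cols (H : {set 'I_f}) (cH : #|H| = e) (cHb : #|~: H| = g) :
  \det (row_mx (unit_cols (set_cols cHb)) phi) =
  (-1) ^+ odd_perm (nabla_perm H) * row_minor phi cH.
Proof.
set s := nabla_perm H; rewrite -[LHS](signrMK s); congr (_ * _).
rewrite -det_perm -det_mulmx -row_permE.
have sE k : s k = nth k (enum (~: H) ++ enum H) k by rewrite permE.
have sl k : s (lshift e k) = set_cols cHb k.
  rewrite sE /= nth_cat -cardE cHb ltn_ord /set_cols /enum_val.
  by apply: set_nth_default; rewrite -cardE cHb.
have sr i : s (rshift g i) = enum_val (cast_ord (esym cH) i).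
  rewrite sE /= nth_cat -cardE cHb ltnNge leq_addr /= addKn /enum_val.
  by apply: set_nth_default; rewrite -cardE cH.
have -> : row_perm s (row_mx (unit_cols (set_cols cHb)) phi) =
    block_mx 1%:M (rowsub (set_cols cHb) phi) 0
             (rowsub (fun i => enum_val (cast_ord (esym cH) i)) phi).
  apply/matrixP => i j; rewrite mxE.
  case: (split_ordP i) => {}i ->; case: (split_ordP j) => {}j ->;
    rewrite ?block_mxEul ?block_mxEur ?block_mxEdl ?block_mxEdr
            ?row_mxEl ?row_mxEr ?sl ?sr !mxE //.
    by rewrite /set_cols (inj_eq enum_val_inj) (inj_eq (@cast_ord_inj _ _ _)).
  case: eqP => // E; have := enum_valP (cast_ord (esym cH) i).
  by rewrite E => xH; have := enum_valP (cast_ord (esym cHb) j); rewrite inE xH.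
by rewrite det_ublock det1 mul1r.
Qed.

Lemma twisted_minor_set_cols a (H : {set 'I_f}) (cH : #|H| = e) (cHb : #|~: H| = g) :
  twisted_minor a (unit_cols (set_cols cHb)) =
  col_minor psi cHb + (-1) ^+ odd_perm (nabla_perm H) * a * row_minor phi cH.
Proof.
by rewrite /twisted_minor mulmx_unit_cols (det_row_mx_set_cols cH) mulrCA mulrA.
Qed.

(** The columns are those of the increasing listing of the image of [h], up to a permutation matrix
    [P]; [H] is the complement of this image. *)
Lemma unit_cols_set_cols (h : 'I_g -> 'I_f) (hi : injective h) :
  exists (H : {set 'I_f}) (cH : #|H| = e) (cHb : #|~: H| = g) (P : 'M[R]_g),
    unit_cols h = unit_cols (set_cols cHb) *m P.
Proof.
have c0 : #|[set h k | k : 'I_g]| = g by rewrite card_imset // card_ord.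
have cH : #|~: [set h k | k : 'I_g]| = e.
  by apply/eqP; rewrite -(eqn_add2l g) -{1}c0 cardsC card_ord.
have cHb : #|~: ~: [set h k | k : 'I_g]| = g by rewrite setCK.
exists (~: [set h k | k : 'I_g]), cH, cHb.
have hin k : h k \in ~: ~: [set h k | k : 'I_g] by rewrite setCK imset_f.
pose s k := cast_ord cHb (enum_rank_in (hin k) (h k)).
have sE k : set_cols cHb (s k) = h k.
  by rewrite /set_cols /s cast_ord_comp cast_ord_id enum_rankK_in.
exists (\matrix_(k, l) (k == s l)%:R); apply/matrixP => j l.
rewrite !mxE (bigD1 (s l)) //= !mxE eqxx mulr1 sE big1 ?addr0 // => k /negPf ks.
by rewrite !mxE ks mulr0.
Qed.

(** Allowing every matrix X makes stability under ring maps and changes of basis visible; the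
    variant with unit columns has finitely many generators. *)
Definition twisted_ideal (a : R) : R -> Prop :=
  ideal_gen (fun p => (exists k i, p = (psi *m phi) k i) \/
                      (exists X, p = twisted_minor a X)).

Definition unit_twisted_ideal (a : R) : R -> Prop :=
  ideal_gen (fun p => (exists k i, p = (psi *m phi) k i) \/
                      (exists h : {ffun 'I_g -> 'I_f}, p = twisted_minor a (unit_cols h))).

Lemma twisted_idealE a p : twisted_ideal a p <-> unit_twisted_ideal a p.
Proof.
split; apply: ideal_gen_mono => {}p [h|[X ->]].
- by apply: ideal_gen_base; left.
- rewrite twisted_minor_expand; apply: ideal_gen_sum => h _; apply: ideal_gen_mem.
  by right; exists h.
- by apply: ideal_gen_base; left.
- by apply: ideal_gen_base; right; exists (unit_cols X).
Qed.

(** Expansion reduces X to unit columns. Repeated columns contribute 0, and distinct ones give a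
    generator of J up to the determinant of a permutation matrix. *)
Lemma idealJ_twisted a p : idealJ phi psi a p <-> twisted_ideal a p.
Proof.
split; last rewrite twisted_idealE; apply: ideal_gen_mono => {}p [h|].
- by apply: ideal_gen_base; left.
- move=> [H [cH [cHb ->]]]; rewrite -twisted_minor_set_cols.
  by apply: ideal_gen_base; right; exists (unit_cols (set_cols cHb)).
- by apply: ideal_gen_base; left.
move=> [h ->]; have [/injectiveP hi|/injectiveP hn] := boolP (injectiveb h); last first.
  by rewrite (twisted_minor_noninj a hn); exact: ideal_gen0.
have [H [cH [cHb [P ->]]]] := unit_cols_set_cols hi.
rewrite twisted_minorM mulrC; apply: ideal_gen_mem; right.
by exists H, cH, cHb; rewrite (twisted_minor_set_cols _ cH).
Qed.

Lemma idealI_twisted p : idealI phi psi p <-> twisted_ideal 0 p.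
Proof.
rewrite -idealJ_twisted; split; apply: ideal_gen_mono => {}p [h|].
- by apply: ideal_gen_base; left.
- move=> [S [cS ->]]; apply: ideal_gen_base; right.
  have cH : #|~: S| = e by apply/eqP; rewrite -(eqn_add2l g) -{1}cS cardsC card_ord.
  (* S must appear as the complement of its complement; generalizing over [T] carries the
     cardinality proof along this equality. *)
  suff [T TS [cT ->]] : exists2 T, ~: ~: S = T & exists cT : #|T| = g,
      col_minor psi cS = col_minor psi cT.
    rewrite -TS in cT *; exists (~: S), cH, cT.
    by rewrite mulr0 mul0r addr0.
  by rewrite setCK; exists S => //; exists cS.
- by apply: ideal_gen_base; left.
move=> [H [cH [cHb ->]]]; rewrite mulr0 mul0r addr0.
by apply: ideal_gen_base; right; exists (~: H), cHb.
Qed.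

(** Multiply [X | phi] on the left by the block matrix with rows psi and [0 | 1]. The product has
    upper right block psi phi, hence is block lower triangular modulo [ideal1]. *)
Lemma complementary_minor_swap (X : 'M[R]_(f, g)) :
  ideal1 phi psi (\det (lsubmx psi) * \det (row_mx X phi) -
                  \det (dsubmx phi) * \det (psi *m X)).
Proof.
rewrite [X in _ - X]mulrC -(det_lblock (psi *m X) (dsubmx X) (dsubmx phi)).
rewrite -[X in X * _ - _]mulr1 -(det1 R e) -(det_ublock (lsubmx psi) (rsubmx psi)).
rewrite -det_mulmx; apply: det_cong => i j.
rewrite -[X in row_mx X](vsubmxK X) -[X in row_mx _ X](vsubmxK phi) -block_mxEh.
rewrite mulmx_block !mul0mx !add0r !mul1mx -!mul_row_col hsubmxK !vsubmxK.
case: (split_ordP i) => {}i ->; case: (split_ordP j) => {}j ->;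
    rewrite ?block_mxEul ?block_mxEur ?block_mxEdl ?block_mxEdr ?subrr; try exact: ideal_gen0.
by rewrite [X in _ - X]mxE subr0; apply: ideal_gen_base; exists i, j.
Qed.

End ComplementaryMinors.

(** The twisted minor at X goes to the one at [be *m map_mx s X]: in det[s(X) | be' phi al] the
    factors be' and al split off with determinant 1. *)
Lemma twisted_ideal_invariant (R : comNzRingType) (e g : nat) (s : {rmorphism R -> R})
    (phi : 'M[R]_(g + e, e)) (psi : 'M[R]_(g, g + e)) (a : R)
    (al : 'M[R]_e) (be be' : 'M[R]_(g + e)) (ga : 'M[R]_g) :
  map_mx s phi = be' *m phi *m al -> map_mx s psi = ga *m psi *m be -> s a = a ->
  be *m be' = 1%:M -> \det al = 1 -> \det be' = 1 -> \det ga = 1 ->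
  forall p, twisted_ideal phi psi a p -> twisted_ideal phi psi a (s p).
Proof.
move=> sphi spsi sa beK dal dbe dga; apply: ideal_gen_sub => p [[k [i ->]]|[X ->]].
  have -> : s ((psi *m phi) k i) = (ga *m (psi *m phi) *m al) k i.
    transitivity (map_mx s (psi *m phi) k i); first by rewrite [RHS]mxE.
    by rewrite map_mxM /= sphi spsi !mulmxA -(mulmxA (ga *m psi)) beK mulmx1.
  rewrite mxE; apply: ideal_gen_sum => i' _; rewrite mulrC mxE mulr_sumr.
  apply: ideal_gen_sum => k' _; rewrite mulrA; apply: ideal_gen_mem; left.
  by exists k', i'.
apply: ideal_gen_base; right; exists (be *m map_mx s X).
rewrite /twisted_minor rmorphD rmorphM /= sa -!det_map_mx map_mxM map_row_mx.
rewrite sphi spsi -!mulmxA det_mulmx dga mul1r; congr (_ + _ * _).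
have -> : row_mx (map_mx s X) (be' *m (phi *m al)) =
          be' *m row_mx (be *m map_mx s X) (phi *m al).
  by rewrite mul_mx_row (mulmxA be' be) (mulmx1C beK) mul1mx.
rewrite det_mulmx dbe mul1r -[be *m _ in LHS](mulmx1 (be *m _)) det_row_mx_mulr.
by rewrite det1 dal !mulr1.
Qed.

(** * Substitutions, and the specialization a = 0 *)

Lemma mpoly_ring_ind (K : fieldType) (N : nat) (P : {mpoly K[N]} -> Prop) :
  (forall c, P c%:MP) -> (forall i, P 'X_i) ->
  (forall p q, P p -> P q -> P (p + q)) -> (forall p q, P p -> P q -> P (p * q)) ->
  forall p, P p.
Proof.
move=> PC PX PD PM p; rewrite [p]mpolyE.
elim/big_ind: _ => [|q r|m _]; [by rewrite -[0]mpolyC0|exact: PD|].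
rewrite -mul_mpolyC; apply: (PM) => //; rewrite mpolyXE_id.
elim/big_ind: _ => [|q r|i _]; [by rewrite -[1]mpolyC1|exact: PM|].
elim: (m i) => [|n IH]; first by rewrite expr0 -[1]mpolyC1.
by rewrite exprS; exact: PM.
Qed.

Section Substitution.
Variables (K : fieldType) (N M : nat) (v : 'rV[{mpoly K[M]}]_N).

(** Unlike [subst] it may change the number of variables; for equal numbers the two are
    convertible. *)
Definition csubst (p : {mpoly K[N]}) : {mpoly K[M]} := p \mPo [tuple v 0 i | i < N].

HB.instance Definition _ := GRing.RMorphism.copy csubst
  (comp_mpoly [tuple v 0 i | i < N]).

Lemma csubstX i : csubst 'X_i = v 0 i.
Proof. by rewrite /csubst comp_mpolyXU -tnth_nth tnth_mktuple. Qed.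

Lemma csubstC c : csubst c%:MP = c%:MP.
Proof. exact: comp_mpolyC. Qed.

Lemma csubst_homog (W : zmodType) (w : 'I_N -> W) (w' : 'I_M -> W) :
  (forall i, whomog w' (w i) (v 0 i)) ->
  forall d p, whomog w d p -> whomog w' d (csubst p).
Proof.
move=> hv d p hp; rewrite /csubst comp_mpolyEX big_seq; apply: whomog_sum => m /hp <-.
rewrite comp_mpolyX; apply: whomogZ; rewrite /mwt; apply: whomog_prod => i _; rewrite tnth_mktuple.
elim: (m i) => [|n IH]; first by rewrite expr0 -mpolyC1; exact: whomogC.
by rewrite exprS mulrS; exact: whomogM.
Qed.

Lemma csubst_mcoeff0 : (forall i, (v 0 i)@_0%MM = 0) ->
  forall p, (csubst p)@_0%MM = p@_0%MM.
Proof.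
move=> h; apply: mpoly_ring_ind => [c|i|p q|p q].
- by rewrite csubstC !mcoeffC !eqxx.
- by rewrite csubstX h mcoeffX mnm1_eq0.
- by rewrite rmorphD !mcoeffD => -> ->.
- by rewrite !rmorphM /= => -> ->.
Qed.

End Substitution.

Lemma map_mx_csubst_C (K : fieldType) (N M : nat) (v : 'rV[{mpoly K[M]}]_N) m n
    (X : 'M[K]_(m, n)) :
  map_mx (csubst v) (map_mx (@mpolyC N K) X) = map_mx (@mpolyC M K) X.
Proof. by apply/matrixP => i j; rewrite !mxE csubstC. Qed.

Lemma csubst_var (K : fieldType) (N M : nat) (v : 'rV[{mpoly K[M]}]_N) :
  map_mx (csubst v) (\row_i 'X_i) = v.
Proof. by apply/matrixP => i j; rewrite !mxE ord1 csubstX. Qed.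

Lemma mcoeff0_mulmx (K : fieldType) m n p q (X : 'M[K]_(m, n)) N (Y : 'M[{mpoly K[N]}]_(n, p))
    (Z : 'M[K]_(p, q)) : map_mx (mcoeff 0%MM) Y = 0 ->
  map_mx (mcoeff 0%MM) (map_mx (@mpolyC N K) X *m Y *m map_mx (@mpolyC N K) Z) = 0.
Proof. by move=> Y0; rewrite !map_mxM /= Y0 mulmx0 mul0mx. Qed.

Section SetAZero.
Variables (K : fieldType) (e f g : nat).
Local Notation A := (A K e f g).
Local Notation B := (B K e f g).
Local Notation phiA := (phiA K e f g).
Local Notation psiA := (psiA K e f g).
Local Notation phiB := (phiB K e f g).
Local Notation psiB := (psiB K e f g).
Local Notation a := (aB K e f g).

Definition toA : B -> A := csubst (row_mx (varA K e f g) 0).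
Definition toB : A -> B := csubst (lsubmx (varB K e f g)).

HB.instance Definition _ := GRing.RMorphism.on toA.
HB.instance Definition _ := GRing.RMorphism.on toB.

Lemma toA_varl : map_mx toA (lsubmx (varB K e f g)) = varA K e f g.
Proof. by apply/matrixP => i j; rewrite !mxE /toA csubstX row_mxEl !mxE. Qed.

Lemma toB_varA : map_mx toB (varA K e f g) = lsubmx (varB K e f g).
Proof. by apply/matrixP => i j; rewrite ord1 !mxE /toB csubstX !mxE. Qed.

Lemma toA_a : toA a = 0.
Proof. by rewrite /aB !mxE /toA csubstX row_mxEr mxE. Qed.

Lemma toA_phi : map_mx toA phiB = phiA.
Proof. by rewrite /phiB map_vec_mx map_lsubmx toA_varl. Qed.

Lemma toA_psi : map_mx toA psiB = psiA.
Proof. by rewrite /psiB map_vec_mx map_rsubmx toA_varl. Qed.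

Lemma toB_phi : map_mx toB phiA = phiB.
Proof. by rewrite /phiA map_vec_mx map_lsubmx toB_varA. Qed.

Lemma toB_psi : map_mx toB psiA = psiB.
Proof. by rewrite /psiA map_vec_mx map_rsubmx toB_varA. Qed.

Lemma toBK : cancel toB toA.
Proof.
apply: mpoly_ring_ind => [c|i|p q Ep Eq|p q Ep Eq].
- by rewrite /toB /toA !csubstC.
- by rewrite /toB csubstX !mxE /toA csubstX row_mxEl mxE.
- by rewrite !rmorphD /= Ep Eq.
- by rewrite !rmorphM /= Ep Eq.
Qed.

(** Division with remainder by a; in particular the kernel of [toA] is aB. *)
Lemma toAK (b : B) : exists b', b = toB (toA b) + a * b'.
Proof.
elim/mpoly_ring_ind: b => [c|i|p q [p' Ep] [q' Eq]|p q [p' Ep] [q' Eq]].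
- by exists 0; rewrite /toB /toA !csubstC mulr0 addr0.
- case: (split_ordP i) => {}i ->.
    by exists 0; rewrite /toA csubstX row_mxEl mxE /toB csubstX !mxE mulr0 addr0.
  by exists 1; rewrite /toA csubstX row_mxEr mxE rmorph0 add0r mulr1 ord1 /aB !mxE.
- by exists (p' + q'); rewrite {1}Ep {1}Eq !rmorphD mulrDr addrACA.
exists (p' * toB (toA q) + toB (toA p) * q' + a * p' * q').
rewrite {1}Ep {1}Eq !rmorphM /=; ring.
Qed.

Lemma toAK_mx m n (M : 'M[B]_(m, n)) :
  exists M', M = map_mx toB (map_mx toA M) + a *: M'.
Proof.
have [M' E] := fin_all_exists (fun i => fin_all_exists (fun j => toAK (M i j))).
by exists (\matrix_(i, j) M' i j); apply/matrixP => i j; rewrite !mxE.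
Qed.

Lemma toA_mx_eq0 m n (M : 'M[B]_(m, n)) : map_mx toA M = 0 -> exists M', M = a *: M'.
Proof.
by move=> M0; have [M' ->] := toAK_mx M; exists M'; rewrite M0 map_mx0 add0r.
Qed.

Lemma a_neq0 : a != 0.
Proof.
apply/eqP => /(congr1 (mcoeff U_(rshift (nA e f g) 0))).
by rewrite /aB !mxE mcoeffX eqxx mcoeff0 => /eqP; rewrite oner_eq0.
Qed.

Lemma toA_mcoeff0 b : (toA b)@_0%MM = b@_0%MM.
Proof.
apply: csubst_mcoeff0 => i; case: (split_ordP i) => {}i ->.
  by rewrite row_mxEl mxE mcoeffX mnm1_eq0.
by rewrite row_mxEr mxE mcoeff0.
Qed.

Lemma toA_bihomog d b : bihomog (wB e f g) d b -> bihomog (wA e f g) d (toA b).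
Proof.
apply: (@csubst_homog _ _ _ _ _ (fun i => wB e f g 0 i) (fun i => wA e f g 0 i)) => i.
case: (split_ordP i) => {}i ->.
  by rewrite /wB !row_mxEl [X in whomog _ _ X]mxE;
     exact: (@whomogXU _ _ _ (fun i => wA e f g 0 i) i).
by rewrite !row_mxEr !mxE; exact: whomog0.
Qed.

(** * The group action and its compatibility with a = 0 *)

Section Action.
Variables (al : 'M[K]_e) (be : 'M[K]_f) (ga : 'M[K]_g).
Local Notation cA := (map_mx (@mpolyC (nA e f g) K)).
Local Notation cB := (map_mx (@mpolyC (nB e f g) K)).

Definition rowA : 'rV[A]_(nA e f g) :=
  row_mx (mxvec (cA (invmx be) *m phiA *m cA al)) (mxvec (cA (invmx ga) *m psiA *m cA be)).

Definition rowB : 'rV[B]_(nB e f g) :=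
  row_mx (row_mx (mxvec (cB (invmx be) *m phiB *m cB al))
                 (mxvec (cB (invmx ga) *m psiB *m cB be))) (const_mx a).

Lemma actAE : actA al be ga = csubst rowA. Proof. by []. Qed.
Lemma actBE : actB al be ga = csubst rowB. Proof. by []. Qed.

Lemma actA_phi : map_mx (csubst rowA) phiA = cA (invmx be) *m phiA *m cA al.
Proof. by rewrite {2}/phiA map_vec_mx map_lsubmx csubst_var row_mxKl mxvecK. Qed.

Lemma actA_psi : map_mx (csubst rowA) psiA = cA (invmx ga) *m psiA *m cA be.
Proof. by rewrite {2}/psiA map_vec_mx map_rsubmx csubst_var row_mxKr mxvecK. Qed.

Lemma actB_phi : map_mx (csubst rowB) phiB = cB (invmx be) *m phiB *m cB al.
Proof. by rewrite {2}/phiB map_vec_mx !map_lsubmx csubst_var !row_mxKl mxvecK. Qed.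

Lemma actB_psi : map_mx (csubst rowB) psiB = cB (invmx ga) *m psiB *m cB be.
Proof.
by rewrite {2}/psiB map_vec_mx map_rsubmx map_lsubmx csubst_var row_mxKl row_mxKr mxvecK.
Qed.

Lemma actB_a : csubst rowB a = a.
Proof. by rewrite {1}/aB !mxE csubstX row_mxEr mxE. Qed.

Lemma toA_act b : toA (csubst rowB b) = csubst rowA (toA b).
Proof.
elim/mpoly_ring_ind: b => [c|i|p q Ep Eq|p q Ep Eq].
- by rewrite /toA !csubstC.
- rewrite {2}/toA !csubstX; case: (split_ordP i) => {}i ->; last first.
    by rewrite !row_mxEr !mxE toA_a rmorph0.
  rewrite !row_mxEl [X in csubst rowA X]mxE csubstX.
  transitivity (map_mx toA (row_mx (mxvec (cB (invmx be) *m phiB *m cB al))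
                 (mxvec (cB (invmx ga) *m psiB *m cB be))) 0 i); first by rewrite [RHS]mxE.
  rewrite map_row_mx !map_mxvec !map_mxM /= toA_phi toA_psi.
  by rewrite !map_mx_csubst_C.
- by rewrite !rmorphD /= Ep Eq.
- by rewrite !rmorphM /= Ep Eq.
Qed.

Lemma actA_mcoeff0 p : (csubst rowA p)@_0%MM = p@_0%MM.
Proof.
apply: csubst_mcoeff0 => i.
transitivity (map_mx (mcoeff 0%MM) rowA 0 i); first by rewrite [RHS]mxE.
rewrite /rowA map_row_mx !map_mxvec !mcoeff0_mulmx ?linear0 ?row_mx0 ?mxE //.
  by apply/matrixP => k j; rewrite mxE psiAE mcoeffX mnm1_eq0 mxE.
by apply/matrixP => k j; rewrite mxE phiAE mcoeffX mnm1_eq0 mxE.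
Qed.

End Action.
End SetAZero.

(** * Regularity of a and invariance of the ideals *)

Lemma unit_twisted_ideal_elem (R : comNzRingType) (e g : nat) (phi : 'M[R]_(g + e, e))
    (psi : 'M[R]_(g, g + e)) (a x : R) : unit_twisted_ideal phi psi a x ->
  exists (b : 'I_g * 'I_e -> R) (c : {ffun 'I_g -> 'I_(g + e)} -> R),
    x = \sum_p b p * (psi *m phi) p.1 p.2 +
        \sum_h c h * twisted_minor phi psi a (unit_cols R h).
Proof.
move: x; apply: ideal_gen_ind => [|x y [b [c ->]] [b' [c' ->]]|r s [[k [i ->]]|[h ->]]].
- exists (fun=> 0), (fun=> 0); rewrite !big1 ?addr0 // => p _; by rewrite mul0r.
- exists (fun p => b p + b' p), (fun h => c h + c' h).
  under [X in _ = X + _]eq_bigr do rewrite mulrDl.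
  under [X in _ = _ + X]eq_bigr do rewrite mulrDl.
  by rewrite !big_split /= addrACA.
- exists (fun p => if p == (k, i) then r else 0), (fun=> 0).
  rewrite [X in _ + X]big1 => [|h _]; last by rewrite mul0r.
  rewrite (bigD1 (k, i)) //= eqxx big1 ?addr0 // => p /negPf ->; by rewrite mul0r.
- exists (fun=> 0), (fun h' => if h' == h then r else 0).
  rewrite [X in X + _]big1 => [|p _]; last by rewrite mul0r.
  by rewrite (bigD1 h) //= eqxx big1 ?addr0 ?add0r // => p /negPf ->; rewrite mul0r.
Qed.

Section UniversalRing.
Variables (K : fieldType) (e g : nat).
Local Notation f := (g + e)%N.
Local Notation A := (A K e f g).
Local Notation B := (B K e f g).
Local Notation phiA := (phiA K e f g).
Local Notation psiA := (psiA K e f g).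
Local Notation phiB := (phiB K e f g).
Local Notation psiB := (psiB K e f g).
Local Notation a := (aB K e f g).
Local Notation toA := (@toA K e f g).
Local Notation toB := (@toB K e f g).
Local Notation I := (twisted_ideal phiA psiA 0).
Local Notation J := (twisted_ideal phiB psiB a).

(** Multiply by the first minor of psi, trade the two kinds of minors by [complementary_minor_swap],
    and cancel the regular factor. *)
Lemma minor_relation_swap (T : finType) (c : T -> A) (X : T -> 'M[A]_(f, g)) :
  ideal1 phiA psiA (\sum_t c t * \det (psiA *m X t)) ->
  ideal1 phiA psiA (\sum_t c t * \det (row_mx (X t) phiA)).
Proof.
move=> h; apply: last_minor_regular.
have -> : (\sum_t c t * \det (row_mx (X t) phiA)) * \det (lsubmx psiA) =
  \sum_t c t * (\det (lsubmx psiA) * \det (row_mx (X t) phiA) -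
                \det (dsubmx phiA) * \det (psiA *m X t)) +
  \det (dsubmx phiA) * \sum_t c t * \det (psiA *m X t).
  rewrite mulr_suml mulr_sumr -big_split; apply: eq_bigr => t _ /=.
  by rewrite mulrBr [_ * (_ * \det (psiA *m _))]mulrCA subrK mulrAC mulrA.
apply: ideal_genD; last exact: ideal_genM.
by apply: ideal_gen_sum => t _; apply/ideal_genM/complementary_minor_swap.
Qed.

Lemma toA_twisted_minor (X : 'M[B]_(f, g)) :
  toA (twisted_minor phiB psiB a X) = \det (psiA *m map_mx toA X).
Proof.
by rewrite /twisted_minor rmorphD rmorphM /= toA_a mul0r addr0 -det_map_mx
           map_mxM toA_psi.
Qed.

Lemma toB_det_psi (X : 'M[A]_(f, g)) :
  toB (\det (psiA *m X)) = \det (psiB *m map_mx toB X).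
Proof. by rewrite -det_map_mx map_mxM toB_psi. Qed.

Lemma toB_det_phi (X : 'M[A]_(f, g)) :
  toB (\det (row_mx X phiA)) = \det (row_mx (map_mx toB X) phiB).
Proof. by rewrite -det_map_mx map_row_mx toB_phi. Qed.

Lemma toA_entry k i : toA ((psiB *m phiB) k i) = (psiA *m phiA) k i.
Proof. by rewrite -toA_psi -toA_phi -map_mxM [RHS]mxE. Qed.

Lemma toB_entry k i : toB ((psiA *m phiA) k i) = (psiB *m phiB) k i.
Proof. by rewrite -toB_psi -toB_phi -map_mxM [RHS]mxE. Qed.

Lemma toA_ideal b : J b -> I (toA b).
Proof.
apply: ideal_gen_sub => s [[k [i ->]]|[X ->]]; apply: ideal_gen_base.
  by left; exists k, i; exact: toA_entry.
by right; exists (map_mx toA X); rewrite /= toA_twisted_minor /twisted_minor mul0r addr0.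
Qed.

(** The generator det(psi X) lifts to the twisted minor, the correction being a det[X | phi]. *)
Lemma toB_ideal q : I q -> exists b, J (toB q + a * b).
Proof.
move: q; apply: ideal_gen_ind => [|p q [b hp] [b' hq]|c s [[k [i ->]]|[X ->]]].
- by exists 0; rewrite rmorph0 mulr0 addr0; exact: ideal_gen0.
- by exists (b + b'); rewrite rmorphD mulrDr addrACA; exact: ideal_genD.
- exists 0; rewrite mulr0 addr0 rmorphM /= toB_entry.
  by apply: ideal_gen_mem; left; exists k, i.
exists (toB c * \det (row_mx (map_mx toB X) phiB)).
rewrite /twisted_minor mul0r addr0 rmorphM /= toB_det_psi mulrCA -mulrDr.
by apply: ideal_gen_mem; right; exists (map_mx toB X).
Qed.

(* A relation among the generators of I lifts to one among the generators of J:
   if sum c_h det(psi X_h) lies in I_1(psi phi), so does sum c_h det[X_h | phi]. *)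
Lemma a_regular p : J (a * p) -> J p.
Proof.
rewrite !twisted_idealE => /unit_twisted_ideal_elem [b [c E]].
have [b' Eb] := fin_all_exists (fun k => toAK (b k)).
have [c' Ec] := fin_all_exists (fun h => toAK (c h)).
pose X h := unit_cols A (h : {ffun 'I_g -> 'I_f}).
have X1 h : map_mx toB (X h) = unit_cols B h.
  by apply/matrixP => j k; rewrite !mxE rmorph_nat.
have X2 h : map_mx toA (unit_cols B (h : {ffun 'I_g -> 'I_f})) = X h.
  by apply/matrixP => j k; rewrite !mxE rmorph_nat.
(* Setting a = 0 in [E] gives a relation among the generators of I. *)
have E0 : \sum_k toA (b k) * (psiA *m phiA) k.1 k.2 +
          \sum_h toA (c h) * \det (psiA *m X h) = 0.
  have := congr1 toA E; rewrite rmorphM /= toA_a mul0r rmorphD !rmorph_sum /= => E0.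
  rewrite [RHS]E0.
  congr (_ + _); apply: eq_bigr => k _; rewrite rmorphM /= ?toA_entry //.
  by rewrite toA_twisted_minor X2.
have I1 : ideal1 phiA psiA (\sum_h toA (c h) * \det (psiA *m X h)).
  move/eqP: E0; rewrite addrC addr_eq0 => /eqP ->; apply: ideal_genN.
  by apply: ideal_gen_sum => k _; apply: ideal_gen_mem; exists k.1, k.2.
have {I1} /minor_relation_swap I2 := I1.
have J2 : unit_twisted_ideal phiB psiB a (toB (\sum_h toA (c h) * \det (row_mx (X h) phiA))).
  apply: ideal_gen_sub I2 => s [k [i ->]]; rewrite /= toB_entry.
  by apply: ideal_gen_base; left; exists k, i.
have {E0} /(congr1 toB) := E0.
rewrite rmorph0 rmorphD !rmorph_sum /= => E0.
(* Split each coefficient of [E] into remainder and multiple of a. By [E0] the remainders contribute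
   only their det[X | phi] terms, which carry a factor a; the right-hand side is the quotient by
   a. *)
suff -> : p = \sum_k b' k * (psiB *m phiB) k.1 k.2
    + toB (\sum_h toA (c h) * \det (row_mx (X h) phiA))
    + \sum_h c' h * twisted_minor phiB psiB a (unit_cols B h).
  apply: ideal_genD; last first.
    by apply: ideal_gen_sum => h _; apply: ideal_gen_mem; right; exists h.
  apply: ideal_genD => //.
  by apply: ideal_gen_sum => k _; apply: ideal_gen_mem; left; exists k.1, k.2.
apply: (mulfI (a_neq0 K e f g)); rewrite E !mulrDr rmorph_sum /= !mulr_sumr.
rewrite -[LHS]subr0 -[X in _ - X]E0 opprD addrACA -!sumrB -addrA -big_split /=.
congr (_ + _); apply: eq_bigr => k _.
  by rewrite rmorphM /= toB_entry {1}Eb; ring.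
by rewrite !rmorphM /= toB_det_psi toB_det_phi X1 {1}Ec /twisted_minor; ring.
Qed.

Lemma actB_ideal al be ga : \det al = 1 -> \det be = 1 -> \det ga = 1 ->
  forall b, J b -> J (actB al be ga b).
Proof.
move=> dal dbe dga b; rewrite actBE.
have ube : be \in unitmx by rewrite unitmxE dbe unitr1.
apply: (twisted_ideal_invariant (actB_phi _ _ _) (actB_psi _ _ _) (actB_a _ _ _)).
- by rewrite -map_mxM /= mulmxV // map_scalar_mx.
- by rewrite det_map_mx dal.
- by rewrite det_map_mx det_inv dbe invr1.
- by rewrite det_map_mx det_inv dga invr1.
Qed.

Lemma actA_ideal al be ga : \det al = 1 -> \det be = 1 -> \det ga = 1 ->
  forall q, I q -> I (actA al be ga q).
Proof.
move=> dal dbe dga b; rewrite actAE.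
have ube : be \in unitmx by rewrite unitmxE dbe unitr1.
apply: (twisted_ideal_invariant (actA_phi _ _ _) (actA_psi _ _ _) (rmorph0 _)).
- by rewrite -map_mxM /= mulmxV // map_scalar_mx.
- by rewrite det_map_mx dal.
- by rewrite det_map_mx det_inv dbe invr1.
- by rewrite det_map_mx det_inv dga invr1.
Qed.

(** The generators are bihomogeneous. This is what permits taking the degree 0 part of a comparison
    map over A. *)
Lemma idealI_hcomp d q : idealI phiA psiA q ->
  idealI phiA psiA (hcomp (fun i => wA e f g 0 i) d q).
Proof.
have phiH j i : whomog (fun i => wA e f g 0 i) ((1, 0) : bidegree) (phiA j i).
  rewrite phiAE; have := @whomogXU K _ _ (fun i => wA e f g 0 i) (lshift (g * f) (mxvec_index j i)).
  by rewrite /wA row_mxEl mxE.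
have psiH k j : whomog (fun i => wA e f g 0 i) ((0, 1) : bidegree) (psiA k j).
  rewrite psiAE; have := @whomogXU K _ _ (fun i => wA e f g 0 i) (rshift (f * e) (mxvec_index k j)).
  by rewrite /wA row_mxEr mxE.
move: q; apply: ideal_gen_ind => [|p q hp hq|c s h].
- by rewrite linear0; exact: ideal_gen0.
- by rewrite linearD; exact: ideal_genD.
have [d' hs] : exists d', whomog (fun i => wA e f g 0 i) d' s.
  case: h => [[k [i ->]]|[S [cS ->]]].
    exists ((0, 1) + (1, 0) : bidegree); rewrite mxE; apply: whomog_sum => j _.
    exact: whomogM.
  exists (\sum_(k < g) ((0, 1) : bidegree)); apply: whomog_sum => s' _.
  by apply/whomog_sign/whomog_prod => k _; rewrite mxE.
by rewrite (hcompM _ _ hs); exact: ideal_gen_mem.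
Qed.

End UniversalRing.

(** * Comparison of resolutions *)

Lemma mxBE (V : zmodType) m n (X Y : 'M[V]_(m, n)) i j : (X - Y) i j = X i j - Y i j.
Proof. by rewrite !mxE. Qed.

Section RowLifting.
Variables (K : fieldType) (N : nat) (w : 'rV[bidegree]_N) (I : {mpoly K[N]} -> Prop).
Local Notation R := {mpoly K[N]}.
Variable P : free_resolution w I.

Lemma diff_diff n : diff P n.+1 *m diff P n = 0.
Proof.
apply/row_matrixP => i; rewrite row_mul row0; apply/diff_exact.
by exists (delta_mx 0 i); rewrite rowE.
Qed.

Lemma diff_aug k : I ((diff P 0 *m aug P) k 0).
Proof.
have := (aug_exact (f := P) (row k (diff P 0))).2; rewrite -row_mul mxE; apply.
by exists (delta_mx 0 k); rewrite rowE.
Qed.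

Lemma mx_lift m n (M : 'M[R]_(m, rank P n.+1)) : M *m diff P n = 0 ->
  exists U, M = U *m diff P n.+1.
Proof.
move=> M0; have h i : exists u, row i M = u *m diff P n.+1.
  by apply/diff_exact; rewrite -row_mul M0 row0.
have [U UE] := fin_all_exists h.
exists (\matrix_i U i); apply/row_matrixP => i.
by rewrite UE row_mul rowK.
Qed.

Lemma mx_lift0 m (M : 'M[R]_(m, rank P 0)) : (forall k, I ((M *m aug P) k 0)) ->
  exists U, M = U *m diff P 0.
Proof.
move=> M0; have h i : exists u, row i M = u *m diff P 0.
  by apply/aug_exact; rewrite -row_mul mxE; exact: M0.
have [U UE] := fin_all_exists h.
exists (\matrix_i U i); apply/row_matrixP => i.
by rewrite UE row_mul rowK.
Qed.

End RowLifting.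

Lemma fiberM (K : fieldType) N m n p (X : 'M[{mpoly K[N]}]_(m, n))
    (Y : 'M[{mpoly K[N]}]_(n, p)) :
  fiber (X *m Y) = fiber X *m fiber Y.
Proof. exact: map_mxM. Qed.

Section Comparison.
Variables (K : fieldType) (N : nat) (w : 'rV[bidegree]_N) (S : {mpoly K[N]} -> Prop).
Local Notation R := {mpoly K[N]}.
Local Notation I := (ideal_gen S).
Local Notation resolution := (free_resolution w I).

(** For P = P' this is [semilinear_lift]; for s the identity it is a comparison map of
    resolutions. *)
Definition chain_lift (s : R -> R) (P P' : resolution)
    (T : forall n, 'M[R]_(rank P n, rank P' n)) : Prop :=
  (forall k, I ((T 0%N *m aug P') k 0 - s (aug P k 0))) /\
  (forall n, map_mx s (diff P n) *m T n = T n.+1 *m diff P' n).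

Lemma mulmx_ideal m n (X : 'M[R]_(m, n)) (Y : 'cV[R]_n) :
  (forall k, I (Y k 0)) -> forall k, I ((X *m Y) k 0).
Proof. by move=> h k; rewrite mxE; apply: ideal_gen_sum => i _; exact: ideal_genM. Qed.

Section Existence.
Variables (s : {rmorphism R -> R}) (P P' : resolution).
Hypothesis sI : forall x, I x -> I (s x).

Lemma chain_lift_exists : exists T, chain_lift s (P := P) (P' := P') T.
Proof.
have [v hv] := aug_surj P'.
(* The row [v] is sent to 1 modulo I, so multiples of it lift any prescribed augmentation. *)
pose T0 : 'M[R]_(rank P 0, rank P' 0) := map_mx s (aug P) *m v.
have hT0 k : I ((T0 *m aug P' - map_mx s (aug P)) k 0).
  have -> : (T0 *m aug P' - map_mx s (aug P)) k 0 =
            s (aug P k 0) * ((v *m aug P') 0 0 - 1).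
    by rewrite /T0 -mulmxA mxE [X in X + _]mxE big_ord1 mulrBr mulr1 2!mxE ord1
               [X in _ + X]mxE [X in _ - X]mxE.
  exact: ideal_genM.
clearbody T0; have [T1 hT1] : exists T1, map_mx s (diff P 0) *m T0 = T1 *m diff P' 0.
  apply: mx_lift0 => k.
  have -> : (map_mx s (diff P 0) *m T0 *m aug P') k 0 =
     (map_mx s (diff P 0) *m (T0 *m aug P' - map_mx s (aug P))) k 0
      + s ((diff P 0 *m aug P) k 0).
    rewrite mulmxBr -map_mxM mulmxA; by rewrite mxBE [X in _ - X + _]mxE subrK.
  apply: ideal_genD; first by apply: mulmx_ideal => j; exact: hT0.
  by apply: sI; exact: diff_aug.
(* The recursion carries two consecutive maps, as the next one depends on their commutation; the
   condition is boolean so that [sigW] can extract a witness. *)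
pose good n (T : 'M[R]_(rank P n, rank P' n) * 'M[R]_(rank P n.+1, rank P' n.+1)) :=
  map_mx s (diff P n) *m T.1 == T.2 *m diff P' n.
have step n T : good n T -> exists U, good n.+1 (T.2, U).
  move=> /eqP gT; have [|U UE] := @mx_lift _ _ _ _ P' _ n (map_mx s (diff P n.+1) *m T.2).
    by rewrite -mulmxA -gT mulmxA -map_mxM diff_diff map_mx0 mul0mx.
  by exists U; apply/eqP.
pose build := fix build n : {T | good n T} :=
  match n return {T | good n T} with
  | 0 => exist _ (T0, T1) (introT eqP hT1)
  | m.+1 => let: exist T gT := build m in
            let: exist U gU := sigW (step m T gT) in exist _ (T.2, U) gU
  end.
exists (fun n => (sval (build n)).1); split=> [k|n].
  by have := hT0 k; rewrite mxBE [X in _ - X]mxE.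
have /eqP -> := svalP (build n); congr (_ *m _).
rewrite /=; case: (build n) => T gT.
by case: (sigW _).
Qed.

(** The homotopy is given separately in each degree; no coherent family is assembled, since each Tor
    is compared on its own. *)
Lemma chain_lift_homotopy T T' : chain_lift s (P := P) (P' := P') T ->
  chain_lift s (P := P) (P' := P') T' ->
  exists h0, T 0%N - T' 0%N = h0 *m diff P' 0 /\
  forall n, exists h h', T n.+1 - T' n.+1 = map_mx s (diff P n) *m h + h' *m diff P' n.+1.
Proof.
move=> [T0 Tn] [T'0 T'n].
have [h0 E0] : exists h0, T 0%N - T' 0%N = h0 *m diff P' 0.
  apply: mx_lift0 => k; rewrite mulmxBl mxBE.
  rewrite -(subrKA (s (aug P k 0))) -[X in _ + X]opprB; exact: ideal_genB.
have DE n : (T n.+1 - T' n.+1) *m diff P' n = map_mx s (diff P n) *m (T n - T' n).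
  by rewrite mulmxBl mulmxBr -Tn -T'n.
exists h0; split=> //; elim=> [|n [h [h' E]]].
  have [|h1 E1] := @mx_lift _ _ _ _ P' _ 0 (T 1%N - T' 1%N - map_mx s (diff P 0) *m h0).
    by rewrite mulmxBl DE E0 mulmxA subrr.
  by exists h0, h1; rewrite -E1 [RHS]addrC subrK.
have [|h2 E2] := @mx_lift _ _ _ _ P' _ n.+1 (T n.+2 - T' n.+2 - map_mx s (diff P n.+1) *m h').
  rewrite mulmxBl DE -mulmxA -mulmxBr E addrK mulmxA -map_mxM diff_diff map_mx0.
  by rewrite mul0mx.
by exists h', h2; rewrite -E2 [RHS]addrC subrK.
Qed.

Hypothesis s0 : forall x, (s x)@_0%MM = x@_0%MM.

Lemma fiber_map m n (M : 'M[R]_(m, n)) : fiber (map_mx s M) = fiber M.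
Proof. by apply/matrixP => i j; rewrite !mxE s0. Qed.

End Existence.
End Comparison.

(** * Tor as cycles modulo boundaries of row vectors *)

Section FiberCycles.
Variables (K : fieldType) (N : nat) (w : 'rV[bidegree]_N) (I : {mpoly K[N]} -> Prop).
Variable P : free_resolution w I.

Definition fiber_cycle (i : nat) : 'rV[K]_(rank P i) -> Prop :=
  match i return 'rV[K]_(rank P i) -> Prop with
  | 0 => fun=> True
  | n.+1 => fun z => z *m fiber (diff P n) = 0
  end.

Definition fiber_boundary (i : nat) (z : 'rV[K]_(rank P i)) : Prop :=
  exists u, z = u *m fiber (diff P i).

Lemma Tor_cyclesP i z : z \in Tor_cycles P i <-> fiber_cycle z.
Proof.
case: i z => [|n] z /=; first by rewrite memvf.
by rewrite memv_ker lfunE /=; split=> [/eqP|/eqP].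
Qed.

Lemma Tor_class_cycle i (z : subvs_of (Tor_cycles P i)) : fiber_cycle (vsval z).
Proof. by apply/Tor_cyclesP/subvsP. Qed.

Lemma Tor_class_eq i (z z' : subvs_of (Tor_cycles P i)) :
  Tor_class z = Tor_class z' <-> fiber_boundary (vsval z - vsval z').
Proof.
have E : (z - z' \in Tor_boundaries P i) <-> fiber_boundary (vsval z - vsval z').
  rewrite /Tor_boundaries -memv_preim lfunE /=.
  split=> [/memv_imgP [u _ ->]|[u ->]]; first by exists u; rewrite lfunE.
  by apply/memv_imgP; exists u; rewrite ?memvf // lfunE.
by rewrite -E; split=> [/vquot_eqP|/vquot_eqP].
Qed.

Lemma Tor_classP i (x : Tor P i) : exists z, x = Tor_class z.
Proof. exact: vquot_classP. Qed.

Lemma subvs_of_cycle i z : @fiber_cycle i z ->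
  exists z' : subvs_of (Tor_cycles P i), vsval z' = z.
Proof. by move=> /Tor_cyclesP hz; exists (Subvs hz). Qed.

End FiberCycles.

(** * Maps between Tor modules *)

Section TorMap.
Variables (K : fieldType) (N N' : nat) (w : 'rV[bidegree]_N) (w' : 'rV[bidegree]_N').
Variables (I : {mpoly K[N]} -> Prop) (I' : {mpoly K[N']} -> Prop).
Variables (P : free_resolution w I) (Q : free_resolution w' I') (i : nat).
Variable M : 'M[K]_(rank P i, rank Q i).
Hypothesis Mcycle : forall z, @fiber_cycle _ _ _ _ P i z -> @fiber_cycle _ _ _ _ Q i (z *m M).
Hypothesis Mboundary :
  forall z, @fiber_boundary _ _ _ _ P i z -> @fiber_boundary _ _ _ _ Q i (z *m M).

Lemma Tor_map_exists : exists theta : {linear Tor P i -> Tor Q i},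
  forall z z', vsval z' = vsval z *m M -> theta (Tor_class z) = Tor_class z'.
Proof.
pose F (z : subvs_of (Tor_cycles P i)) : subvs_of (Tor_cycles Q i) :=
  vsproj (Tor_cycles Q i) (vsval z *m M).
have FE z : vsval (F z) = vsval z *m M.
  by rewrite /F vsprojK //; apply/Tor_cyclesP/Mcycle/Tor_class_cycle.
(* The map uses the chosen representative; preservation of boundaries makes the choice
   irrelevant. *)
pose t (x : vquot (Tor_boundaries P i)) : Tor Q i := Tor_class (F (generic_quotient.repr x)).
have tE z z' : vsval z' = vsval z *m M -> t (Tor_class z) = Tor_class z'.
  move=> E; apply/Tor_class_eq; rewrite FE E -mulmxBl; apply: Mboundary.
  by apply/Tor_class_eq; rewrite /Tor_class /vquot_class generic_quotient.reprK.
have t_lin : linear t.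
  move=> c x y; have [u ->] := Tor_classP x; have [v ->] := Tor_classP y.
  rewrite (tE u (F u)) ?FE // (tE v (F v)) ?FE //.
  have -> : c *: Tor_class u + Tor_class v = Tor_class (c *: u + v).
    by rewrite /Tor_class vquot_classD vquot_classZ.
  rewrite (tE _ (c *: F u + F v)).
    by rewrite /Tor_class vquot_classD vquot_classZ.
  by rewrite /= !FE mulmxDl scalemxAl.
pose theta : {linear Tor P i -> Tor Q i} :=
  HB.pack t (GRing.isLinear.Build K (Tor P i) (Tor Q i) _ t t_lin).
by exists theta.
Qed.

End TorMap.

Section FiberMaps.
Variables (K : fieldType) (N : nat) (w : 'rV[bidegree]_N) (S : {mpoly K[N]} -> Prop).
Local Notation R := {mpoly K[N]}.
Local Notation I := (ideal_gen S).
Local Notation resolution := (free_resolution w I).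

Section Semilinear.
Variables (s : {rmorphism R -> R}) (P P' : resolution).
Hypothesis s0 : forall x, (s x)@_0%MM = x@_0%MM.
Variable T : forall n, 'M[R]_(rank P n, rank P' n).
Hypothesis sT : chain_lift s T.

Lemma fiber_chain n : fiber (diff P n) *m fiber (T n) = fiber (T n.+1) *m fiber (diff P' n).
Proof. by rewrite -[RHS]fiberM -(sT.2 n) fiberM fiber_map. Qed.

Lemma fiber_lift_cycle i (z : 'rV_(rank P i)) :
  fiber_cycle z -> fiber_cycle (z *m fiber (T i)).
Proof.
case: i z => [//|n] z /= z0.
by rewrite -mulmxA -fiber_chain mulmxA z0 mul0mx.
Qed.

Lemma fiber_lift_boundary i (z : 'rV_(rank P i)) :
  fiber_boundary z -> fiber_boundary (z *m fiber (T i)).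
Proof.
by move=> [u ->]; exists (u *m fiber (T i.+1)); rewrite -!mulmxA fiber_chain.
Qed.

(** Of the two homotopy terms, the one starting with the differential kills cycles and the other is
    a boundary. *)
Lemma fiber_lift_unique T' i (z : 'rV_(rank P i)) : chain_lift s T' -> fiber_cycle z ->
  fiber_boundary (z *m fiber (T i) - z *m fiber (T' i)).
Proof.
move=> sT'; have [h0 [E0 E]] := chain_lift_homotopy sT sT'.
rewrite -mulmxBr -map_mxB; case: i z => [|n] z z0.
  by rewrite E0 map_mxM mulmxA; exists (z *m fiber h0).
have [h [h' ->]] := E n.
rewrite map_mxD !map_mxM /= -/(fiber _) -/(fiber _) -/(fiber _) -/(fiber _) fiber_map //.
by rewrite mulmxDr !mulmxA z0 mul0mx add0r; exists (z *m fiber h').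
Qed.

End Semilinear.

(** Matrices act on the right and the second map is t-semilinear, so t is applied to the first
    matrix. *)
Lemma chain_lift_comp (s t : {rmorphism R -> R}) (P P' P'' : resolution) T U :
  (forall x, I x -> I (t x)) ->
  chain_lift s (P := P) (P' := P') T -> chain_lift t (P := P') (P' := P'') U ->
  chain_lift (t \o s) (fun n => map_mx t (T n) *m U n).
Proof.
move=> tI [T0 Tn] [U0 Un]; split=> [k|n].
  have -> : (map_mx t (T 0%N) *m U 0%N *m aug P'') k 0 - (t \o s) (aug P k 0) =
    (map_mx t (T 0%N) *m (U 0%N *m aug P'' - map_mx t (aug P'))) k 0 +
     t ((T 0%N *m aug P') k 0 - s (aug P k 0)).
    by rewrite mulmxBr -map_mxM mulmxA mxBE rmorphB [X in _ - X + _]mxE /= addrA subrK.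
  apply: ideal_genD; last exact: tI.
  by apply: mulmx_ideal => j; rewrite mxBE [X in _ - X]mxE.
rewrite -mulmxA -Un !mulmxA -map_mxM -Tn; congr (_ *m _).
by rewrite map_mxM; congr (_ *m _); apply/matrixP => i j; rewrite !mxE.
Qed.

Lemma chain_lift_id (P : resolution) : chain_lift idfun (fun n => 1%:M : 'M_(rank P n)).
Proof.
split=> [k|n]; first by rewrite mul1mx subrr; exact: ideal_gen0.
by rewrite /= map_mx_id // mulmx1 mul1mx.
Qed.

Section DegreeZero.
Hypothesis I_graded : forall d x, I x -> I (hcomp (fun i => w 0 i) d x).
Variables (P P' : resolution) (T : forall n, 'M[R]_(rank P n, rank P' n)).

Definition degree0_part n : 'M[R]_(rank P n, rank P' n) :=
  \matrix_(j, k) hcomp (fun i => w 0 i) (deg j - deg k) (T n j k).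

(** The differentials are homogeneous, so the chain map equations hold in each bidegree separately;
    the augmentation condition also uses that I is graded. *)
Lemma chain_lift_degree0 : chain_lift idfun T -> chain_lift idfun degree0_part.
Proof.
move=> [T0 Tn]; split=> [k|n].
  have -> : (degree0_part 0 *m aug P') k 0 - idfun (aug P k 0) =
      hcomp (fun i => w 0 i) (deg k) ((T 0%N *m aug P') k 0 - aug P k 0).
    rewrite linearB /= [X in _ = _ - X]hcomp_id; last exact: aug_bihomog.
    congr (_ - _); rewrite !mxE linear_sum; apply: eq_bigr => j _.
    by rewrite mxE /= (hcompM _ _ (@aug_bihomog _ _ _ _ P' j)).
  exact: I_graded.
apply/matrixP => j k; have := congr1 (fun M : 'M_(_, _) => M j k) (Tn n).
rewrite map_mx_id // => /(congr1 (hcomp (fun i => w 0 i) (deg j - deg k))).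
rewrite !mxE !linear_sum /= => E.
transitivity (\sum_i hcomp (fun i0 => w 0 i0) (deg j - deg k) (diff P n j i * T n i k)).
  apply: eq_bigr => l _; rewrite mxE mulrC [in RHS]mulrC.
  rewrite (hcompM _ _ (@diff_bihomog _ _ _ _ P n j l)).
  by congr (hcomp _ _ _ * _); rewrite opprB [RHS]addrC subrKA.
rewrite E; apply: eq_bigr => l _.
rewrite mxE (hcompM _ _ (@diff_bihomog _ _ _ _ P' n l k)).
by congr (hcomp _ _ _ * _); rewrite opprB subrKA.
Qed.

(** A constant term has bidegree 0. *)
Lemma fiber_degree0 n j k : deg j != deg k -> fiber (degree0_part n) j k = 0.
Proof.
move=> jk; rewrite !mxE mcoeff_hcomp mwt0 eq_sym subr_eq0.
by rewrite (negPf jk).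
Qed.

End DegreeZero.
End FiberMaps.

(** * Reduction of a resolution modulo a *)

Section ReductionModA.
Variables (K : fieldType) (e g : nat).
Local Notation f := (g + e)%N.
Local Notation A := (A K e f g).
Local Notation B := (B K e f g).
Local Notation a := (aB K e f g).
Local Notation toA := (@toA K e f g).
Local Notation toB := (@toB K e f g).
Local Notation I := (idealI (phiA K e f g) (psiA K e f g)).
Local Notation J := (idealJ (phiB K e f g) (psiB K e f g) a).
Variable Q : free_resolution (wB e f g) J.

Lemma toA_idealJ b : J b -> I (toA b).
Proof. by move=> /idealJ_twisted /toA_ideal h; apply/idealI_twisted. Qed.

Lemma idealJ_regular b : J (a * b) -> J b.
Proof. by move=> /idealJ_twisted /a_regular h; apply/idealJ_twisted. Qed.

Lemma toB_idealI q : I q -> exists b, J (toB q + a * b).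
Proof. by move=> /idealI_twisted /toB_ideal [b h]; exists b; apply/idealJ_twisted. Qed.

Lemma toBK_mx m n (M : 'M[A]_(m, n)) : map_mx toA (map_mx toB M) = M.
Proof. by apply/matrixP => i j; rewrite !mxE toBK. Qed.

Lemma scalemxI m n (M M' : 'M[B]_(m, n)) : a *: M = a *: M' -> M = M'.
Proof.
move=> /matrixP E; apply/matrixP => i j; have := E i j; rewrite !mxE.
exact: (mulfI (a_neq0 K e f g)).
Qed.

Lemma reduce_aug_surj : exists v : 'rV_(rank Q 0), I ((v *m map_mx toA (aug Q)) 0 0 - 1).
Proof.
have [v /toA_idealJ h] := aug_surj Q; exists (map_mx toA v).
by move: h; rewrite rmorphB rmorph1 /= -map_mxM [X in _ -> I (X - _)]mxE.
Qed.

Lemma reduce_aug_exact (v : 'rV_(rank Q 0)) :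
  I ((v *m map_mx toA (aug Q)) 0 0) <-> exists u, v = u *m map_mx toA (diff Q 0).
Proof.
split=> [|[u ->]]; last first.
  rewrite -(toBK_mx u) -mulmxA -!map_mxM mxE; apply: toA_idealJ.
  by apply: mulmx_ideal => k; exact: (@diff_aug _ _ _ _ Q k).
move=> /toB_idealI [b hb].
have [v1 hv1] := aug_surj Q.
have [c Ec] : exists c, (map_mx toB v *m aug Q) 0 0 =
    toB ((v *m map_mx toA (aug Q)) 0 0) + a * c.
  have [c Ec] := toAK ((map_mx toB v *m aug Q) 0 0); exists c; rewrite {1}Ec.
  congr (toB _ + _).
  by rewrite -[in RHS](toBK_mx v) -map_mxM [RHS]mxE.
(* The lift of [v] has augmentation in J only up to a multiple of a. A multiple of [v1], which
   augments to 1 modulo J, corrects this and disappears at a = 0. *)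
have : exists u, map_mx toB v + (a * (b - c)) *: v1 = u *m diff Q 0.
  apply/aug_exact; rewrite mulmxDl -scalemxAl.
  have -> : (map_mx toB v *m aug Q + (a * (b - c)) *: (v1 *m aug Q)) 0 0 =
     (map_mx toB v *m aug Q) 0 0 + (a * (b - c)) * (v1 *m aug Q) 0 0 by rewrite mxE [X in _ + X]mxE.
  rewrite Ec; set x := (v1 *m _) 0 0 in hv1 *; set y := toB _ in hb *.
  have -> : y + a * c + a * (b - c) * x = (y + a * b) + (a * (b - c)) * (x - 1) by ring.
  by apply: ideal_genD => //; exact: ideal_genM.
move=> [u Eu]; exists (map_mx toA u).
rewrite -map_mxM -Eu map_mxD toBK_mx map_mxZ /= rmorphM /= toA_a mul0r scale0r.
by rewrite addr0.
Qed.

(** The boundary of a lift of [v] is a multiple a x. Here x is itself a boundary of some u, and the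
    lift minus a u is a cycle over B. *)
Lemma reduce_diff_exact n (v : 'rV_(rank Q n.+1)) :
  v *m map_mx toA (diff Q n) = 0 <-> exists u, v = u *m map_mx toA (diff Q n.+1).
Proof.
split=> [|[u ->]]; last by rewrite -mulmxA -map_mxM diff_diff map_mx0 mulmx0.
rewrite -{1}(toBK_mx v) -map_mxM => /toA_mx_eq0 [x Ex].
(* Cancelling a needs its regularity on B/J in the lowest degree, and only on free modules above. *)
have [u Eu] : exists u, x = u *m diff Q n.
  case: n v x Ex => [|n] v x Ex.
    apply/aug_exact/idealJ_regular.
    have -> : a * (x *m aug Q) 0 0 = (map_mx toB v *m (diff Q 0 *m aug Q)) 0 0.
      by rewrite mulmxA Ex -scalemxAl [RHS]mxE.
    by apply: mulmx_ideal => k; exact: (@diff_aug _ _ _ _ Q k).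
  apply/diff_exact/scalemxI.
  by rewrite scaler0 scalemxAl -Ex -mulmxA diff_diff mulmx0.
have : exists t, map_mx toB v - a *: u = t *m diff Q n.+1.
  by apply/diff_exact; rewrite mulmxBl Ex Eu scalemxAl subrr.
move=> [t Et]; exists (map_mx toA t).
by rewrite -map_mxM -Et map_mxB toBK_mx map_mxZ /= toA_a scale0r subr0.
Qed.

Lemma toA_mx_bihomog m n (M : 'M[B]_(m, n)) d i j :
  bihomog (wB e f g) d (M i j) -> bihomog (wA e f g) d (map_mx toA M i j).
Proof. by rewrite mxE; exact: toA_bihomog. Qed.

(** Ranks and degrees are those of [Q] by computation, so the fibers of both complexes consist of
    the same row vectors. *)
Definition reduce : free_resolution (wA e f g) I := FreeResolution
  (fun n j k => toA_mx_bihomog (@diff_bihomog _ _ _ _ Q n j k))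
  (fun k => toA_mx_bihomog (@aug_bihomog _ _ _ _ Q k))
  reduce_aug_surj reduce_aug_exact reduce_diff_exact.
End ReductionModA.

(** * The isomorphism *)

Section TorMapDegree.
Variables (K : fieldType) (N N' : nat) (w : 'rV[bidegree]_N) (w' : 'rV[bidegree]_N').
Variables (I : {mpoly K[N]} -> Prop) (I' : {mpoly K[N']} -> Prop).
Variables (P : free_resolution w I) (Q : free_resolution w' I') (i : nat).
Variable M : 'M[K]_(rank P i, rank Q i).
Hypothesis Mcycle : forall z, @fiber_cycle _ _ _ _ P i z -> @fiber_cycle _ _ _ _ Q i (z *m M).
Hypothesis Mdeg : forall j k, deg j != deg k -> M j k = 0.
Variable theta : Tor P i -> Tor Q i.
Hypothesis thetaE : forall z z', vsval z' = vsval z *m M -> theta (Tor_class z) = Tor_class z'.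

Lemma Tor_map_bideg d x : Tor_bideg d x -> Tor_bideg d (theta x).
Proof.
move=> [z -> hz]; have [u uE] := subvs_of_cycle (Mcycle (Tor_class_cycle z)).
exists u; first exact: thetaE.
move=> k kd; rewrite uE mxE big1 // => j _.
have [jd|/hz ->] := eqVneq (deg j) d; last by rewrite mul0r.
by rewrite Mdeg ?mulr0 // jd eq_sym.
Qed.

End TorMapDegree.

Lemma fiber_boundaryB (K : fieldType) (N : nat) (w : 'rV[bidegree]_N)
    (I : {mpoly K[N]} -> Prop) (P : free_resolution w I) i (z z' : 'rV[K]_(rank P i)) :
  fiber_boundary z -> fiber_boundary z' -> fiber_boundary (z - z').
Proof. by move=> [u ->] [v ->]; exists (u - v); rewrite mulmxBl. Qed.

Section Main.
Variables (K : fieldType) (e g : nat).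
Local Notation f := (g + e)%N.
Local Notation A := (A K e f g).
Local Notation B := (B K e f g).
Local Notation toA := (@toA K e f g).
Local Notation I := (idealI (phiA K e f g) (psiA K e f g)).
Local Notation J := (idealJ (phiB K e f g) (psiB K e f g) (aB K e f g)).

Section Reduce.
Variable Q : free_resolution (wB e f g) J.
Local Notation Qb := (reduce Q).

Lemma fiber_toA m n (M : 'M[B]_(m, n)) : fiber (map_mx toA M) = fiber M.
Proof. by apply/matrixP => i j; rewrite !mxE toA_mcoeff0. Qed.

Lemma reduce_cycle i (z : 'rV_(rank Q i)) :
  @fiber_cycle _ _ _ _ Qb i z <-> @fiber_cycle _ _ _ _ Q i z.
Proof. by case: i z => [|n] z //=; rewrite fiber_toA. Qed.

Lemma reduce_boundary i (z : 'rV_(rank Q i)) :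
  @fiber_boundary _ _ _ _ Qb i z <-> @fiber_boundary _ _ _ _ Q i z.
Proof. by rewrite /fiber_boundary /= fiber_toA. Qed.

Lemma reduce_lift al be ga T : semilinear_lift (P := Q) (actB al be ga) T ->
  semilinear_lift (P := Qb) (actA al be ga) (fun n => map_mx toA (T n)).
Proof.
rewrite actAE actBE => -[T0 Tn]; split=> [k|n].
  have := toA_idealJ (T0 k); rewrite rmorphB /= toA_act => h.
  by rewrite -map_mxM [X in I (X - _)]mxE [X in csubst _ X]mxE.
rewrite /= -map_mxM -Tn map_mxM; congr (_ *m _).
by apply/matrixP => i j; rewrite !mxE /= toA_act.
Qed.

End Reduce.

Variables (P : free_resolution (wA e f g) I) (Q : free_resolution (wB e f g) J).
Variable i : nat.
Local Notation Qb := (reduce Q).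

Lemma degree0_comparison (P1 P2 : free_resolution (wA e f g) I) :
  exists T : forall n, 'M[A]_(rank P1 n, rank P2 n), chain_lift idfun T /\
    forall n j k, deg j != deg k -> fiber (T n) j k = 0.
Proof.
have [T hT] := @chain_lift_exists _ _ _ _ idfun P1 P2 (fun x h => h).
exists (degree0_part T); split; last by move=> *; exact: fiber_degree0.
by apply: chain_lift_degree0 => // d x; exact: idealI_hcomp.
Qed.

(** The composite and the identity matrices both lift the identity of A/I. *)
Lemma comparison_inverse (P1 P2 : free_resolution (wA e f g) I)
    (T : forall n, 'M[A]_(rank P1 n, rank P2 n)) (U : forall n, 'M[A]_(rank P2 n, rank P1 n)) z :
  chain_lift idfun T -> chain_lift idfun U -> @fiber_cycle _ _ _ _ P1 i z ->
  @fiber_boundary _ _ _ _ P1 i (z *m fiber (T i) *m fiber (U i) - z).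
Proof.
move=> hT hU hz.
have h := @chain_lift_comp _ _ _ _ idfun idfun P1 P2 P1 T U (fun x h => h) hT hU.
have := @fiber_lift_unique _ _ _ _ idfun P1 P1 (fun=> erefl) _ h _ i z
   (@chain_lift_id _ _ _ _ P1) hz.
by rewrite fiberM map_mx_id // mulmxA /fiber map_mx1 mulmx1.
Qed.

Lemma Tor_iso : exists theta : {linear Tor P i -> Tor Q i},
    [/\ bijective theta,
        forall (al : 'M[K]_e) (be : 'M[K]_f) (ga : 'M[K]_g),
          \det al = 1 -> \det be = 1 -> \det ga = 1 ->
          forall x y : Tor P i,
            Tor_action (actA al be ga) x y <->
            Tor_action (actB al be ga) (theta x) (theta y)
      & forall (d : bidegree) (x : Tor P i),
          Tor_bideg d x <-> Tor_bideg d (theta x)].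
Proof.
(* The comparison takes place over A; its fibers serve as maps to and from the fiber of [Q]. *)
have [T [hT Tdeg]] := degree0_comparison P Qb.
have [U [hU Udeg]] := degree0_comparison Qb P.
pose M : 'M[K]_(rank P i, rank Q i) := fiber (T i).
pose M' : 'M[K]_(rank Q i, rank P i) := fiber (U i).
have id0 (x : A) : (idfun x)@_0%MM = x@_0%MM by [].
have Mc z : @fiber_cycle _ _ _ _ P i z -> @fiber_cycle _ _ _ _ Q i (z *m M).
  by move=> hz; apply/reduce_cycle; exact: (fiber_lift_cycle id0 hT hz).
have Mb z : @fiber_boundary _ _ _ _ P i z -> @fiber_boundary _ _ _ _ Q i (z *m M).
  by move=> hz; apply/reduce_boundary; exact: (fiber_lift_boundary id0 hT hz).
have M'c z : @fiber_cycle _ _ _ _ Q i z -> @fiber_cycle _ _ _ _ P i (z *m M').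
  by move=> /reduce_cycle hz; exact: (fiber_lift_cycle id0 hU hz).
have M'b z : @fiber_boundary _ _ _ _ Q i z -> @fiber_boundary _ _ _ _ P i (z *m M').
  by move=> /reduce_boundary hz; exact: (fiber_lift_boundary id0 hU hz).
have [theta thetaE] := Tor_map_exists Mc Mb.
have [eta etaE] := Tor_map_exists M'c M'b.
have thetaK : cancel theta eta.
  move=> x; have [z ->] := Tor_classP x.
  have hz := Tor_class_cycle z.
  have [u uE] := subvs_of_cycle (Mc _ hz).
  have [v vE] := subvs_of_cycle (M'c _ (Mc _ hz)).
  rewrite (thetaE z u) // (etaE u v) ?uE //.
  by apply/Tor_class_eq; rewrite vE; exact: comparison_inverse hT hU hz.
have etaK : cancel eta theta.
  move=> x; have [z ->] := Tor_classP x.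
  have hz := Tor_class_cycle z.
  have [u uE] := subvs_of_cycle (M'c _ hz).
  have [v vE] := subvs_of_cycle (Mc _ (M'c _ hz)).
  rewrite (etaE z u) // (thetaE u v) ?uE //.
  apply/Tor_class_eq; rewrite vE; apply/reduce_boundary.
  by apply: (comparison_inverse hU hT); apply/reduce_cycle.
exists theta; split; first by exists eta.
- move=> al be ga dal dbe dga.
  have IA x : I x -> I (csubst (rowA al be ga) x).
    by move=> /idealI_twisted h; apply/idealI_twisted; exact: (actA_ideal dal dbe dga h).
  have JB x : J x -> J (csubst (rowB al be ga) x).
    by move=> /idealJ_twisted h; apply/idealJ_twisted; exact: (actB_ideal dal dbe dga h).
  have s0 := @actA_mcoeff0 K e f g al be ga.
  (* X followed by T, and T followed by Y modulo a, lift the same endomorphism of A/I, hence agree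
     on cycles up to boundaries. *)
  have commute X Y z : semilinear_lift (P := P) (actA al be ga) X ->
      semilinear_lift (P := Q) (actB al be ga) Y -> @fiber_cycle _ _ _ _ P i z ->
      @fiber_boundary _ _ _ _ Q i (z *m fiber (X i) *m M - z *m M *m fiber (Y i)).
    move=> hX /reduce_lift hY hz; apply/reduce_boundary.
    have h1 := @chain_lift_comp _ _ _ _ (csubst (rowA al be ga)) idfun P P Qb X T
       (fun x h => h) hX hT.
    have h2 := @chain_lift_comp _ _ _ _ idfun (csubst (rowA al be ga)) P Qb Qb T _ IA hT hY.
    have := @fiber_lift_unique _ _ _ _ (csubst (rowA al be ga)) P Qb s0 _ h1 _ i z h2 hz.
    by rewrite !fiberM map_mx_id // fiber_map // fiber_toA !mulmxA.
  have [X hX] := @chain_lift_exists _ _ _ _ (csubst (rowA al be ga)) P P IA.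
  have [Y hY] := @chain_lift_exists _ _ _ _ (csubst (rowB al be ga)) Q Q JB.
  have YE := reduce_lift (al := al) (be := be) (ga := ga) hY.
  move=> x y; split.
    move=> [X' hX' [z [z' [-> -> zE]]]].
    have hz := Tor_class_cycle z; have hz' := Tor_class_cycle z'.
    have [u uE] := subvs_of_cycle (Mc _ hz).
    have [v vE] := subvs_of_cycle (Mc _ hz').
    have [|u' u'E] := @subvs_of_cycle _ _ _ _ Q i (vsval u *m fiber (Y i)).
      have := Tor_class_cycle u => /reduce_cycle /(fiber_lift_cycle s0 YE).
      by rewrite fiber_toA => /reduce_cycle.
    exists Y; first exact: hY.
    exists u, u'; split=> //; first exact: thetaE.
    rewrite (thetaE z' v) //; apply/Tor_class_eq; rewrite vE u'E uE zE.
    exact: commute.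
  move=> [Y' hY' [z [z' [xz yz' zE]]]].
  (* Conversely, let X act on x. The image of the result under [theta] and [theta y] are the same
     value of the action at [theta x], and [theta] is injective. *)
  have [u xu] := Tor_classP x; have hu := Tor_class_cycle u.
  have huX := fiber_lift_cycle s0 hX hu.
  have [v vE] := subvs_of_cycle huX.
  have [u1 u1E] := subvs_of_cycle (Mc _ hu).
  have [v1 v1E] := subvs_of_cycle (Mc _ huX).
  exists X; first exact: hX.
  exists u, v; split=> //; apply: (can_inj thetaK).
  rewrite yz' (thetaE v v1) ?vE //; apply/Tor_class_eq; rewrite zE v1E.
  have : fiber_boundary (vsval z - vsval u1).
    by apply/Tor_class_eq; rewrite -xz xu; exact: thetaE.
  move=> /reduce_boundary /(fiber_lift_boundary s0 (reduce_lift hY')).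
  rewrite fiber_toA => /reduce_boundary h1.
  have := fiber_boundaryB h1 (commute X Y' _ hX hY' hu).
  by rewrite u1E mulmxBl opprB subrKA.
- move=> d x; split=> [|h]; first exact: (Tor_map_bideg Mc (@Tdeg i) thetaE).
  by rewrite -[x]thetaK; exact: (Tor_map_bideg M'c (@Udeg i) etaE).
Qed.

End Main.

Theorem theorem5 (K : fieldType) (e f g : nat)
  (hchar : [pchar K] =i pred0)
  (he : (1 <= e)%N) (hg : (1 <= g)%N) (hf : f = (e + g)%N)
  (P : free_resolution (wA e f g) (idealI (phiA K e f g) (psiA K e f g)))
  (Q : free_resolution (wB e f g)
         (idealJ (phiB K e f g) (psiB K e f g) (aB K e f g)))
  (i : nat) :
  exists theta : {linear Tor P i -> Tor Q i},
    [/\ bijective theta,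
        forall (al : 'M[K]_e) (be : 'M[K]_f) (ga : 'M[K]_g),
          \det al = 1 -> \det be = 1 -> \det ga = 1 ->
          forall x y : Tor P i,
            Tor_action (actA al be ga) x y <->
            Tor_action (actB al be ga) (theta x) (theta y)
      & forall (d : bidegree) (x : Tor P i),
          Tor_bideg d x <-> Tor_bideg d (theta x)].
Proof.
(* The order g + e makes the first g columns of psi its left block and the last e rows of phi its
   lower block. *)
by move: hf; rewrite addnC => hf; subst f; exact: Tor_iso.
Qed.
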